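(* Let $f(x)=\frac1x$. There is an irrational $\alpha\in(0,1)$ such that $$\lambda\left(\left|\frac{S_N(f)}{N\log(N)}-1\right|>\epsilon\right)\to0\quad\text{as }N\to\infty,\qquad\forall\epsilon>0,$$ but, for every integer $K\ge1$ and Lebesgue-almost every $x\in[0,1)$, it holds that $$\limsup_{N\to\infty}\frac{S_N^K(f)(x)}{N\log(N)}>1\ge\liminf_{N\to\infty}\frac{S_N^K(f)(x)}{N\log(N)}.$$
   Context: For irrational $\alpha$, $R(x)=x+\alpha\pmod1$ on $[0,1)$; $\lambda$ is Lebesgue measure on $[0,1)$; $S_N(f)(x)=\sum_{n=0}^{N-1}f(R^nx)$; and for $0\le K\le N$ $$S_N^{K}(f)(x)=\sum_{n=0}^{N-1}f(R^nx)-\max_{0\le n_1<\dots<n_K\le N-1}\sum_{j=1}^{K}f(R^{n_j}x)$$ is the sum with the $K$ largest terms removed ($S_N^K(f)=0$ if $K>N$), with the convention $f(0)=0$. *)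

(* Defs.v *)
From mathcomp Require Import all_boot all_order all_algebra.
From mathcomp Require Import all_classical all_reals all_analysis.

Set Implicit Arguments.
Unset Strict Implicit.
Unset Printing Implicit Defensive.

Import Order.TTheory GRing.Theory Num.Theory.
Import numFieldNormedType.Exports.

Local Open Scope classical_set_scope.
Local Open Scope ring_scope.

Definition rotation (R : realType) (alpha x : R) : R :=
  x + alpha - (Num.floor (x + alpha))%:~R.

Definition rot_orbit (R : realType) (alpha x : R) (n : nat) : R :=
  iter n (rotation alpha) x.

Definition birkhoff_sum (R : realType) (alpha : R) (f : R -> R) (N : nat)
    (x : R) : R :=
  \sum_(n < N) f (rot_orbit alpha x n).

(* A choice n_1 < ... < n_K of indices below N is a K-element subset of 'I_N.
   For K <= N the set below is finite and nonempty, so that its supremum is a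
   maximum. *)
Definition largest_sum (R : realType) (alpha : R) (f : R -> R) (K N : nat)
    (x : R) : R :=
  sup [set (\sum_(n in A) f (rot_orbit alpha x n))%R
      | A in [set A : {set 'I_N} | #|A| = K]].

Definition trimmed_sum (R : realType) (alpha : R) (f : R -> R) (K N : nat)
    (x : R) : R :=
  if (K <= N)%N then birkhoff_sum alpha f N x - largest_sum alpha f K N x
  else 0.

(* The value at 0 is 0, since the inverse of 0 is 0 in a field. *)
Definition recip (R : realType) (x : R) : R := x^-1.

(* Main.v *)
Require Import Defs.
From mathcomp Require Import all_boot all_order all_algebra.
From mathcomp Require Import all_classical all_reals all_analysis.
From mathcomp Require Import measurable_realfun ring lra zify.

Set Implicit Arguments.
Unset Strict Implicit.
Unset Printing Implicit Defensive.

Import Order.TTheory GRing.Theory Num.Theory.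
Import numFieldNormedType.Exports.

Local Open Scope classical_set_scope.
Local Open Scope ring_scope.

(** The rotation number is built from its continued fraction. Let q_n be the
    denominators of its convergents, d_n the distance of q_n alpha to the
    nearest integer, and let the partial quotients be (n + 1) 2^n; then ln q_n
    is of order n^2. The two halves of the statement rest on two competing
    effects of these quotients.

    Convergence in measure. Any q_n consecutive orbit points are so evenly
    spread that the number of them in an interval differs from its expectation
    by at most 3 (hits_block). A greedy decomposition of N < q_{n+1} into such
    blocks bounds the discrepancy of N points by D, three times the sum of the
    partial quotients, so that ln D is only of order n (hits_discr). Counting
    the points below 1/t for t up to T = N/D, and summing over t, gives
    N ln N + O(N ln D) for the sum of the reciprocals truncated at T, for every
    starting point (sum_cut_recip_ge, sum_recip_le). The truncated part is
    small outside a set of small measure, by the Markov inequality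
    (weak_law_block). Since ln D is negligible against ln N, the weak law
    follows. It also yields the lower limit: along a suitable sequence of N
    almost every x has a quotient below 1 + eps, and trimming only decreases it.

    Upper limit. For even n, steps of length q_n move a point up by d_n, and
    d_n is about 1/q_{n+1}. If the orbit comes, within q_n steps, into the
    window of width 2^n d_n just below 1, it crosses 0 within 2^n further steps
    of length q_n and then passes u + d_n, ..., u + 2^n d_n with 0 <= u < d_n
    (cluster). These points contribute about q_{n+1} ln(2^n), each of them at
    most 2 q_{n+1}, so that removing K terms does not matter; at time
    N = (2^{n+1} + 1) q_n this is a fixed fraction of N ln N (trimmed_large).

    The window is visited on a set of measure of order 1/n, a divergent series,
    and the visits at different levels are nearly independent: a later level is
    so much finer that it is equidistributed inside each window of an earlier
    one, again by hits_block (window_pairs). The second moment method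
    (second_moment) then shows that almost every x meets infinitely many of the
    windows (windows_ae). *)

(** * Fractional parts and the discrepancy of one block *)

Definition frac (R : realType) (x : R) : R := x - (Num.floor x)%:~R.

Lemma frac_ge0 (R : realType) (x : R) : 0 <= frac x.
Proof. by rewrite subr_ge0 floor_le_tmp. Qed.

Lemma frac_lt1 (R : realType) (x : R) : frac x < 1.
Proof. by rewrite ltrBlDl -(intrD _ _ 1) floorD1_gt. Qed.

Lemma frac_eq (R : realType) (x : R) (m : int) :
  0 <= x - m%:~R < 1 -> frac x = x - m%:~R.
Proof.
move=> /andP[h0 h1]; rewrite /frac (@floor_def _ x m) //.
by rewrite intrD -subr_ge0 h0 -ltrBlDl.
Qed.

Lemma frac_id (R : realType) (x : R) : 0 <= x < 1 -> frac x = x.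
Proof. by move=> h; rewrite (@frac_eq _ x 0) subr0. Qed.

Lemma fracDz (R : realType) (x : R) (m : int) : frac (x + m%:~R) = frac x.
Proof.
rewrite (@frac_eq _ _ (Num.floor x + m)) intrD.
  by rewrite opprD addrACA subrr addr0.
by rewrite opprD addrACA subrr addr0 frac_ge0 frac_lt1.
Qed.

Lemma fracDl (R : realType) (x y : R) : frac (frac x + y) = frac (x + y).
Proof. by rewrite {2}/frac addrAC -rmorphN fracDz. Qed.

Lemma frac_le_id (R : realType) (x : R) : 0 <= x -> frac x <= x.
Proof.
by move=> x0; rewrite lerBlDr lerDl ler0z floor_ge0.
Qed.

(** Turns hit counts into differences of floor sums, which are monotone in
    the starting point. *)
Lemma frac_lt_floor (R : realType) (z y : R) : 0 <= y <= 1 ->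
  (nat_of_bool (frac z < y))%:Z = Num.floor z - Num.floor (z - y).
Proof.
move=> /andP[y0 y1].
have f0 := frac_ge0 z; have f1 := frac_lt1 z.
case: ltP => h.
  rewrite (@floor_def _ (z - y) (Num.floor z - 1)); first by rewrite opprB addrC subrK.
  rewrite subrK intrD; rewrite /frac in f0 f1 h; apply/andP; split; lra.
rewrite (@floor_def _ (z - y) (Num.floor z)) ?subrr //.
rewrite intrD; rewrite /frac in f0 f1 h; apply/andP; split; lra.
Qed.

Lemma floor_addr_frac (R : realType) (z : R) (k : int) (q : nat) : (0 < q)%N ->
  Num.floor (z + k%:~R / q%:R) = ((Num.floor (q%:R * z) + k) %/ q%:Z)%Z.
Proof.
move=> q0; set M := Num.floor (q%:R * z); set t := M + k.
have q0R : 0 < q%:R :> R by rewrite ltr0n.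
have qz : q%:Z != 0 by lia.
apply: floor_def.
have Mf : M%:~R <= q%:R * z by exact: floor_le_tmp.
have Mf1 : q%:R * z < (M + 1)%:~R by exact: floorD1_gt.
have e := divz_eq t q%:Z; have r0 := modz_ge0 t qz.
have r1 : (t %% q%:Z < q%:Z)%Z by rewrite ltz_pmod //; lia.
have -> : z + k%:~R / q%:R = (q%:R * z + k%:~R) / q%:R by field; lra.
rewrite ler_pdivlMr // ltr_pdivrMr //.
have -> : q%:R = (q%:Z)%:~R :> R by [].
rewrite -!intrM.
have h1 : ((t %/ q%:Z)%Z * q%:Z <= t) by lia.
have h2 : (t + 1 <= ((t %/ q%:Z)%Z + 1) * q%:Z) by nia.
rewrite -(ler_int R) in h1; rewrite -(ler_int R) in h2.
rewrite /t !intrD in h1 h2 *; rewrite !intrD in Mf1.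
apply/andP; split; lra.
Qed.

(** As i runs below q, i p runs over all residues modulo q. *)
Lemma sum_divz_shift (p q : nat) (M : int) : (0 < q)%N -> coprime p q ->
  \sum_(i < q) ((M + (i * p)%N%:Z) %/ q%:Z)%Z
    = M + \sum_(i < q) (((i * p)%N%:Z) %/ q%:Z)%Z.
Proof.
move=> q0 pq.
have qz : q%:Z != 0 by lia.
have mods (A : int) : \sum_(i < q) ((A + (i * p)%N%:Z) %% q%:Z)%Z
    = \sum_(i < q) (i : nat)%:Z.
  have hlt (i : 'I_q) : (absz (((A + (i * p)%N%:Z) %% q%:Z)%Z) < q)%N.
    have := modz_ge0 (A + (i * p)%N%:Z) qz.
    have : ((A + (i * p)%N%:Z) %% q%:Z < q%:Z)%Z by rewrite ltz_pmod //; lia.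
    lia.
  pose h (i : 'I_q) : 'I_q := Ordinal (hlt i).
  have hinj : injective h.
    move=> i j /(congr1 val) /= hij.
    have e : ((A + (i * p)%N%:Z) == (A + (j * p)%N%:Z) %[mod q%:Z])%Z.
      apply/eqP.
      have := modz_ge0 (A + (i * p)%N%:Z) qz.
      have := modz_ge0 (A + (j * p)%N%:Z) qz.
      lia.
    rewrite eqz_mod_dvd in e.
    have {}e : (q%:Z %| (i%:Z - j%:Z) * p%:Z)%Z.
      by move: e; congr (_ %| _)%Z; lia.
    rewrite Gauss_dvdzl in e; last by rewrite coprimezE coprime_sym.
    have {}e : (q %| `|(i : nat)%:Z - (j : nat)%:Z|)%N by [].
    have li := ltn_ord i; have lj := ltn_ord j.
    apply: val_inj => /=.
    have : `|(i : nat)%:Z - (j : nat)%:Z|%N = 0%N.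
      apply/eqP; apply: contraT => n0; have := dvdn_leq _ e; lia.
    lia.
  rewrite [RHS](reindex_inj hinj) /=; apply: eq_bigr => i _.
  by rewrite gez0_abs // modz_ge0.
have key (A : int) : (\sum_(i < q) ((A + (i * p)%N%:Z) %/ q%:Z)%Z) * q%:Z
   = A * q%:Z + \sum_(i < q) (i * p)%N%:Z - \sum_(i < q) (i : nat)%:Z.
  rewrite -(mods A) mulr_suml.
  have -> : A * q%:Z = \sum_(i < q) A.
    by rewrite sumr_const card_ord -mulr_natr natz.
  rewrite -big_split /= -sumrB; apply: eq_bigr => i _.
  by apply: (addIr ((A + (i * p)%N%:Z) %% q%:Z)%Z); rewrite subrK -divz_eq.
apply: (mulIf qz); rewrite mulrDl key.
have := key 0.
rewrite (eq_bigr (fun i : 'I_q => ((i * p)%N%:Z %/ q%:Z)%Z)); last by move=> i _; rewrite add0r.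
by move=> ->; rewrite mul0r add0r addrA.
Qed.

Definition hits (R : realType) (alpha : R) (N : nat) (x y : R) : nat :=
  \sum_(i < N) (frac (x + i%:R * alpha) < y)%R.

(** Replacing alpha by p / q moves each of the q points by at most 1 / q, and
    the floor sums of the rational rotation are exactly floor (q z) plus a
    constant. So the count lies between two differences of floors, each within 3
    of q y. *)
Lemma hits_block (R : realType) (alpha x y : R) (p q : nat) :
  (0 < q)%N -> coprime p q -> `|q%:R * alpha - p%:R| <= q%:R^-1 ->
  0 <= y <= 1 -> `|(hits alpha q x y)%:R - q%:R * y| <= 3.
Proof.
move=> q0 pq happ y01.
have q0R : 0 < q%:R :> R by rewrite ltr0n.
pose F (z : R) := \sum_(i < q) Num.floor (z + i%:R * alpha).
pose C := \sum_(i < q) (((i * p)%N%:Z) %/ q%:Z)%Z.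
have G (z : R) : \sum_(i < q) Num.floor (z + (i * p)%N%:R / q%:R)
    = Num.floor (q%:R * z) + C.
  rewrite -sum_divz_shift //; apply: eq_bigr => i _.
  by rewrite -(@floor_addr_frac R z (i * p)%N%:Z q q0).
have near (i : 'I_q) : `|i%:R * alpha - (i * p)%N%:R / q%:R| <= q%:R^-1.
  have -> : i%:R * alpha - (i * p)%N%:R / q%:R
     = (i%:R / q%:R) * (q%:R * alpha - p%:R) by rewrite natrM; field; lra.
  rewrite normrM -[leRHS]mul1r ler_pM //.
  rewrite ger0_norm ?divr_ge0 // ler_pdivrMr // mul1r ler_nat.
  exact: ltnW.
have FU (z : R) : F z <= Num.floor (q%:R * z + 1) + C.
  have -> : q%:R * z + 1 = q%:R * (z + q%:R^-1) by field; lra.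
  rewrite -G; apply: ler_sum => i _; apply: le_floor.
  by have := near i; rewrite ler_norml => /andP[_]; lra.
have FL (z : R) : Num.floor (q%:R * z - 1) + C <= F z.
  have -> : q%:R * z - 1 = q%:R * (z - q%:R^-1) by field; lra.
  rewrite -G; apply: ler_sum => i _; apply: le_floor.
  by have := near i; rewrite ler_norml => /andP[+ _]; lra.
have eh : (hits alpha q x y)%:Z = F x - F (x - y).
  rewrite /hits /F -sumrB -[LHS]natz natr_sum; apply: eq_bigr => i _.
  by rewrite natz frac_lt_floor // addrAC.
have -> : (hits alpha q x y)%:R = (F x - F (x - y))%:~R :> R by rewrite -eh.
have a1 := FU x; have a2 := FL x; have b1 := FU (x - y); have b2 := FL (x - y).
rewrite -(ler_int R) !intrD in a1; rewrite -(ler_int R) !intrD in a2.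
rewrite -(ler_int R) !intrD in b1; rewrite -(ler_int R) !intrD in b2.
have f1 := floor_le_tmp (q%:R * x + 1).
have f2 := floorD1_gt (q%:R * x - 1); rewrite intrD in f2.
have f3 := floor_le_tmp (q%:R * (x - y) + 1).
have f4 := floorD1_gt (q%:R * (x - y) - 1); rewrite intrD in f4.
rewrite !mulrBr in b1 b2 f3 f4.
rewrite rmorphB /= ler_norml; apply/andP; split; lra.
Qed.

(** * Continued fractions with given partial quotients *)

(** Both sequences satisfy u_{n+1} = a_n u_n + u_{n-1}; the state carries the
    last two values. *)
Fixpoint cf_rec (a : nat -> nat) (s : nat * nat) (n : nat) : nat * nat :=
  if n is m.+1 then let t := cf_rec a s m in (a m * t.1 + t.2, t.1)%N else s.

Definition cf_den (a : nat -> nat) (n : nat) : nat := (cf_rec a (1, 0)%N n).1.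

Definition cf_num (a : nat -> nat) (n : nat) : nat := (cf_rec a (0, 1)%N n).1.

Lemma cf_denSS a n : cf_den a n.+2 = (a n.+1 * cf_den a n.+1 + cf_den a n)%N.
Proof. by []. Qed.

Lemma cf_numSS a n : cf_num a n.+2 = (a n.+1 * cf_num a n.+1 + cf_num a n)%N.
Proof. by []. Qed.

Lemma cf_den_geM a n : (a n * cf_den a n <= cf_den a n.+1)%N.
Proof. by rewrite /cf_den /= leq_addr. Qed.

Lemma cf_den_leS a n : (forall k, (0 < a k)%N) ->
  (cf_den a n <= cf_den a n.+1)%N.
Proof. by move=> a0; apply: leq_trans (cf_den_geM a n); rewrite leq_pmull. Qed.

Lemma cf_den_le a m n : (forall k, (0 < a k)%N) -> (m <= n)%N ->
  (cf_den a m <= cf_den a n)%N.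
Proof.
move=> a0; elim: n => [|n IH]; first by rewrite leqn0 => /eqP ->.
rewrite leq_eqVlt => /orP[/eqP -> //|]; rewrite ltnS => /IH h.
exact: leq_trans h (cf_den_leS _ a0).
Qed.

Lemma cf_den_gt0 a n : (forall k, (0 < a k)%N) -> (0 < cf_den a n)%N.
Proof. by move=> a0; exact: (@cf_den_le a 0). Qed.

Lemma cf_den_leM a n : (forall k, (0 < a k)%N) ->
  (cf_den a n.+1 <= (a n).+1 * cf_den a n)%N.
Proof.
move=> a0; case: n => [|n]; first by rewrite /cf_den /=; lia.
by rewrite cf_denSS mulSn addnC leq_add2r cf_den_leS.
Qed.

Lemma cf_den_ge a n : (forall k, (0 < a k)%N) -> (n <= cf_den a n)%N.
Proof.
move=> a0; elim: n => [//|[|n] IH]; first exact: cf_den_gt0.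
rewrite cf_denSS -addn1 leq_add ?cf_den_gt0 //.
by apply: (leq_trans IH); rewrite leq_pmull.
Qed.

Lemma cf_det a n : (cf_num a n.+1)%:Z * (cf_den a n)%:Z
  - (cf_num a n)%:Z * (cf_den a n.+1)%:Z = (-1) ^+ n.
Proof.
elim: n => [|n IH]; first by rewrite /cf_num /cf_den /=; lia.
rewrite exprS -IH cf_denSS cf_numSS.
move: (cf_den a n.+1) (cf_den a n) (cf_num a n.+1) (cf_num a n) => q' q p' p.
by rewrite !PoszD !PoszM; ring.
Qed.

Lemma cf_coprime a n : coprime (cf_num a n) (cf_den a n).
Proof.
rewrite -[coprime _ _]/(coprimez (cf_num a n)%:Z (cf_den a n)%:Z).
apply/coprimezP.
exists (- (-1) ^+ n * (cf_den a n.+1)%:Z, (-1) ^+ n * (cf_num a n.+1)%:Z) => /=.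
transitivity (((-1) ^+ n) * (-1) ^+ n : int); last by rewrite -expr2 sqrr_sign.
by rewrite -(cf_det a n); ring.
Qed.

(** The sign makes these positive for all n exactly when alpha lies above the
    even and below the odd convergents. *)
Definition cf_err (R : realType) (a : nat -> nat) (alpha : R) (n : nat) : R :=
  (-1) ^+ n * ((cf_den a n)%:R * alpha - (cf_num a n)%:R).

Lemma cf_detR (R : realType) a n : (cf_num a n.+1)%:R * (cf_den a n)%:R
  - (cf_num a n)%:R * (cf_den a n.+1)%:R = (-1) ^+ n :> R.
Proof.
have /(congr1 (fun z : int => z%:~R : R)) := cf_det a n.
by rewrite rmorphB /= !intrM rmorphXn /= rmorphN.
Qed.

(** The even convergents increase, the odd ones decrease, and every even one is
    below every odd one; the supremum of the even ones separates them. *)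
Lemma cf_exists (R : realType) a : (forall k, (0 < a k)%N) ->
  exists alpha : R, forall n, 0 < cf_err a alpha n.
Proof.
move=> a0.
pose q n : R := (cf_den a n)%:R; pose c n : R := (cf_num a n)%:R / q n.
have q0 n : 0 < q n by rewrite ltr0n cf_den_gt0.
have cS n : c n.+1 - c n = (-1) ^+ n * ((q n.+1)^-1 * (q n)^-1).
  rewrite -(cf_detR R a n) /c; have := q0 n; have := q0 n.+1; rewrite /q => h h'.
  by field; rewrite ?lt0r_neq0.
have cSS n : 0 < (-1) ^+ n * (c n.+2 - c n).
  have -> : c n.+2 - c n = (c n.+2 - c n.+1) + (c n.+1 - c n) by ring.
  rewrite !cS exprS.
  have -> : (-1) ^+ n * (-1 * (-1) ^+ n * ((q n.+2)^-1 * (q n.+1)^-1)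
      + (-1) ^+ n * ((q n.+1)^-1 * (q n)^-1))
      = ((-1) ^+ n) ^+ 2 * ((q n.+1)^-1 * ((q n)^-1 - (q n.+2)^-1)) by ring.
  rewrite sqrr_sign mul1r mulr_gt0 ?invr_gt0 ?q0 // subr_gt0.
  rewrite ltf_pV2 ?posrE ?q0 // ltr_nat cf_denSS.
  by have := cf_den_gt0 n.+1 a0; have := a0 n.+1; nia.
have evS k : c k.*2 < c k.+1.*2.
  by have := cSS k.*2; rewrite -signr_odd odd_double mul1r subr_gt0.
have odS k : c k.+1.*2.+1 < c k.*2.+1.
  have := cSS k.*2.+1; rewrite -signr_odd /= odd_double /= expr1 mulN1r.
  by rewrite oppr_gt0 subr_lt0.
have eo k : c k.*2 < c k.*2.+1.
  rewrite -subr_gt0 cS -signr_odd odd_double mul1r mulr_gt0 ?invr_gt0 //.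
have evm j k : (j <= k)%N -> c j.*2 <= c k.*2.
  elim: k => [|k IH]; first by rewrite leqn0 => /eqP ->.
  rewrite leq_eqVlt => /orP[/eqP -> //|]; rewrite ltnS => /IH h.
  exact: le_trans h (ltW (evS k)).
have odm j k : (j <= k)%N -> c k.*2.+1 <= c j.*2.+1.
  elim: k => [|k IH]; first by rewrite leqn0 => /eqP ->.
  rewrite leq_eqVlt => /orP[/eqP -> //|]; rewrite ltnS => /IH h.
  exact: le_trans (ltW (odS k)) h.
have all_lt j k : c j.*2 < c k.*2.+1.
  apply: (le_lt_trans (evm j (maxn j k) (leq_maxl _ _))).
  by apply: lt_le_trans (eo _) _; apply: odm; exact: leq_maxr.
pose S : set R := [set c k.*2 | k in setT]%classic.
have S0 : has_sup S.
  split; first by exists (c 0%N); exists 0%N.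
  by exists (c 1%N) => _ [j _ <-]; apply: ltW; exact: (all_lt j 0%N).
exists (sup S) => n.
have qc m : (cf_num a m)%:R = q m * c m :> R.
  by rewrite /c mulrC divfK // lt0r_neq0.
rewrite /cf_err qc -mulrBr mulrCA mulr_gt0 ?(q0 n) //.
rewrite -signr_odd -[in c n](odd_double_half n); case: (odd n) => /=.
  rewrite expr1 mulN1r oppr_gt0 subr_lt0 add1n.
  apply: le_lt_trans (odS _); apply: ge_sup; first by case: S0.
  by move=> _ [j _ <-]; apply: ltW; exact: all_lt.
rewrite expr0 mul1r subr_gt0 add0n.
by apply: lt_le_trans (evS _) _; apply: ub_le_sup; [case: S0|exists (n./2.+1)].
Qed.

Lemma cf_err_sum (R : realType) a (alpha : R) n :
  (cf_den a n.+1)%:R * cf_err a alpha n + (cf_den a n)%:R * cf_err a alpha n.+1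
  = 1.
Proof.
rewrite /cf_err exprS; apply: (@etrans _ _ (((-1) ^+ n) ^+ 2)); last exact: sqrr_sign.
by rewrite [in RHS]expr2 -[X in _ = _ * X](cf_detR R a n); ring.
Qed.

Lemma cf_err_le (R : realType) a (alpha : R) n : (forall k, (0 < a k)%N) ->
  (forall k, 0 < cf_err a alpha k) ->
  (cf_den a n.+1)%:R * cf_err a alpha n <= 1.
Proof.
by move=> a0 h; rewrite -[leRHS](cf_err_sum a alpha n) lerDl mulr_ge0 // ltW.
Qed.

(** In q_{n+1} err_n + q_n err_{n+1} = 1 the second term is at most
    q_n / q_{n+2}, hence at most 1/2. *)
Lemma cf_err_ge (R : realType) a (alpha : R) n : (forall k, (0 < a k)%N) ->
  (forall k, 0 < cf_err a alpha k) ->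
  1 <= 2 * ((cf_den a n.+1)%:R * cf_err a alpha n).
Proof.
move=> a0 h; have s := cf_err_sum a alpha n.
have h2 := cf_err_le n.+1 a0 h.
have : 2 * ((cf_den a n)%:R * cf_err a alpha n.+1) <= 1.
  apply: le_trans h2; rewrite mulrA ler_wpM2r ?(ltW (h _)) // -natrM ler_nat.
  rewrite cf_denSS; have := cf_den_leS n a0; have := a0 n.+1; nia.
lra.
Qed.

Lemma cf_err_block (R : realType) a (alpha : R) n : (forall k, (0 < a k)%N) ->
  (forall k, 0 < cf_err a alpha k) ->
  `|(cf_den a n)%:R * alpha - (cf_num a n)%:R| <= (cf_den a n)%:R^-1.
Proof.
move=> a0 h.
have q0 : 0 < (cf_den a n)%:R :> R by rewrite ltr0n cf_den_gt0.
have -> : `|(cf_den a n)%:R * alpha - (cf_num a n)%:R| = cf_err a alpha n.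
  by rewrite -[RHS]ger0_norm ?(ltW (h n)) // /cf_err normrM normr_sign mul1r.
rewrite -[leRHS]mul1r ler_pdivlMr // mulrC.
apply: le_trans (cf_err_le n a0 h); rewrite ler_wpM2r ?(ltW (h n)) // ler_nat.
exact: cf_den_leS.
Qed.

(** For alpha = r / s the numbers s err_n would be positive integers tending
    to 0. *)
Lemma cf_irrational (R : realType) a (alpha : R) : (forall k, (0 < a k)%N) ->
  (forall k, 0 < cf_err a alpha k) -> ~ exists r : rat, ratr r = alpha.
Proof.
move=> a0 h [r er]; set n := `|denq r|%N.
have dn : n%:R = (denq r)%:~R :> R.
  by rewrite pmulrn /n absz_denq.
have n0 : (0 < n)%N by rewrite /n absz_gt0 denq_neq0.
have n0R : 0 < n%:R :> R by rewrite ltr0n.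
have ea : alpha * n%:R = (numq r)%:~R.
  by rewrite -er /ratr dn divfK // intr_eq0 denq_neq0.
pose z : int := (-1) ^+ n * ((cf_den a n)%:Z * numq r - (cf_num a n)%:Z * n%:Z).
have ez : z%:~R = cf_err a alpha n * n%:R.
  rewrite /z /cf_err intrM rmorphXn rmorphB /= !intrM rmorphN /= -ea.
  by rewrite -mulrA mulrBl mulrA.
have : 0 < z by rewrite -(ltr_int R) ez mulr_gt0.
rewrite gtz0_ge1 -(ler_int R) ez => z1.
have b := cf_err_le n a0 h; have := cf_den_ge n.+1 a0.
rewrite -(ler_nat R) -natr1 => g; have := h n; nra.
Qed.

Lemma hitsD (R : realType) (alpha : R) (m n : nat) (x y : R) :
  hits alpha (m + n) x y = (hits alpha m x y + hits alpha n (x + m%:R * alpha) y)%N.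
Proof.
rewrite /hits big_split_ord /=; congr (_ + _)%N.
by apply: eq_bigr => i _; rewrite natrD mulrDl addrA.
Qed.

(** Three, the discrepancy of one block, for each block that the greedy
    decomposition of an N < q_n may use. *)
Definition discr (a : nat -> nat) (n : nat) : nat := (3 * \sum_(k < n) a k)%N.

(** A greedy decomposition of N into b copies of the block q_n, with b at most
    a_n, and a shorter rest. *)
Lemma hits_discr (R : realType) a (alpha : R) (n N : nat) (x y : R) :
  (forall k, (0 < a k)%N) -> (forall k, 0 < cf_err a alpha k) ->
  (N < cf_den a n)%N -> 0 <= y <= 1 ->
  `|(hits alpha N x y)%:R - N%:R * y| <= (discr a n)%:R.
Proof.
move=> a0 h + y01; elim: n N x => [|n IH] N x.
  rewrite ltnS leqn0 => /eqP ->.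
  by rewrite /hits big_ord0 mul0r subr0 normr0.
set q := cf_den a n => Nq.
have q0 : (0 < q)%N by exact: cf_den_gt0.
have blocks b x' : `|(hits alpha (b * q) x' y)%:R - (b * q)%N%:R * y| <= 3 * b%:R.
  elim: b x' => [|b IHb] x'.
    by rewrite mul0n /hits big_ord0 mul0r subr0 normr0 mulr0.
  rewrite mulSn hitsD !natrD mulrDl -natr1.
  have b1 := hits_block x' q0 (cf_coprime a n) (cf_err_block n a0 h) y01.
  have b2 := IHb (x' + q%:R * alpha).
  rewrite -/q in b1; rewrite !ler_norml in b1 b2 *; lra.
have ba : (N %/ q <= a n)%N.
  rewrite -ltnS ltn_divLR //; apply: leq_trans Nq _; exact: cf_den_leM.
have rq : (N %% q < q)%N by rewrite ltn_mod.
have b1 := blocks (N %/ q)%N x.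
have b2 := IH _ (x + (N %/ q * q)%N%:R * alpha) rq.
have -> : discr a n.+1 = (3 * a n + discr a n)%N.
  by rewrite /discr big_ord_recr /= mulnDr addnC.
rewrite natrD natrM {1 2}(divn_eq N q) hitsD 2!natrD mulrDl.
rewrite -(ler_nat R) in ba.
rewrite !ler_norml in b1 b2 *; lra.
Qed.

(** * Moment bounds for finite families of sets *)

(** Integrates the pointwise inequality. First and second moments are handled
    as finite weighted sums of indicators, which keeps every integral implicit. *)
Lemma weighted_measure_le (d : measure_display) (T : measurableType d)
  (R : realType) (mu : {measure set T -> \bar R}) (I J : Type)
  (r : seq I) (s : seq J) (b : I -> R) (c : J -> R)
  (A : I -> set T) (B : J -> set T) :
  (forall i, measurable (A i)) -> (forall j, measurable (B j)) ->
  (forall i, 0 <= b i) -> (forall j, 0 <= c j) ->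
  (forall x, \sum_(i <- r) b i * \1_(A i) x <= \sum_(j <- s) c j * \1_(B j) x) ->
  (\sum_(i <- r) (b i)%:E * mu (A i) <= \sum_(j <- s) (c j)%:E * mu (B j))%E.
Proof.
move=> mA mB b0 c0 h.
have int (K : Type) (u : seq K) (w : K -> R) (E : K -> set T) :
    (forall k, measurable (E k)) -> (forall k, 0 <= w k) ->
    (\int[mu]_x (\sum_(k <- u) w k * \1_(E k) x)%:E
      = \sum_(k <- u) (w k)%:E * mu (E k))%E.
  move=> mE w0.
  under eq_integral do rewrite -sumEFin.
  rewrite ge0_integral_sum //.
  - apply: eq_bigr => k _.
    under eq_integral do rewrite EFinM.
    rewrite ge0_integralZl ?lee_fin //.
    + by rewrite integral_indic // setIT.
    + by apply/measurable_EFinP; exact: measurable_indic.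
  - move=> k; apply/measurable_EFinP; apply: measurable_funM => //.
  - by move=> k x _; rewrite lee_fin mulr_ge0.
rewrite -(int _ r) // -(int _ s) //; apply: ge0_le_integral => //.
- by move=> x _; rewrite lee_fin sumr_ge0 // => i _; rewrite mulr_ge0.
- apply/measurable_EFinP; apply: measurable_sum => i.
  exact: measurable_funM.
- apply/measurable_EFinP; apply: measurable_sum => i.
  exact: measurable_funM.
- by move=> x _; rewrite lee_fin.
Qed.

(** Chebyshev inequality for the number Z of sets containing a point: Z
    vanishes on G, so (Z - P)^2 is at least P^2 there. *)
Lemma second_moment (d : measure_display) (T : measurableType d)
  (R : realType) (mu : {measure set T -> \bar R}) (D G : set T) (I : eqType)
  (r : seq I) (A : I -> set T) (m : I -> R) (g : R) (Q : I -> I -> R) :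
  measurable D -> measurable G -> (forall i, measurable (A i)) ->
  mu D = 1%E -> G `<=` D -> (forall i, A i `<=` D) ->
  (forall i, i \in r -> G `&` A i = set0) ->
  mu G = g%:E -> (forall i, mu (A i) = (m i)%:E) ->
  (forall i j, (mu (A i `&` A j) <= (Q i j)%:E)%E) ->
  (g + 1) * (\sum_(i <- r) m i) ^+ 2 <= \sum_(i <- r) \sum_(j <- r) Q i j.
Proof.
move=> mD mG mA D1 GD AD GA mug mum muQ.
set P := \sum_(i <- r) m i.
have m0 i : 0 <= m i by rewrite -lee_fin -mum.
have P0 : 0 <= P by rewrite sumr_ge0.
pose r1 := None :: [seq Some i | i <- r].
pose r2 := None :: [seq Some (i, j) | i <- r, j <- r].
pose b (o : option I) := if o is Some i then 2 * P else P ^+ 2.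
pose c (o : option (I * I)) := if o is Some i then 1 else P ^+ 2.
pose A1 (o : option I) := if o is Some i then A i else G.
pose A2 (o : option (I * I)) := if o is Some ij then A ij.1 `&` A ij.2 else D.
have := @weighted_measure_le _ _ _ mu _ _ r1 r2 b c A1 A2.
have big2 (f : option (I * I) -> R) : \sum_(o <- r2) f o
    = f None + \sum_(i <- r) \sum_(j <- r) f (Some (i, j)).
  by rewrite /r2 big_cons big_allpairs_dep.
have -> : (\sum_(o <- r1) (b o)%:E * mu (A1 o)
  = (P ^+ 2 * g + \sum_(i <- r) 2 * P * m i)%:E)%E.
  rewrite /r1 big_cons big_map /= mug EFinD; congr (_ + _)%E.
  by rewrite -sumEFin; apply: eq_bigr => i _; rewrite mum EFinM.
have le2 : (\sum_(o <- r2) (c o)%:E * mu (A2 o)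
  <= (P ^+ 2 + \sum_(i <- r) \sum_(j <- r) Q i j)%:E)%E.
  rewrite /r2 big_cons big_allpairs_dep /= D1 mule1 EFinD leeD2l //.
  rewrite -sumEFin; apply: lee_sum => i _; rewrite -sumEFin; apply: lee_sum => j _.
  by rewrite mul1e.
have mA1 o : measurable (A1 o) by case: o => [i|] /=.
have mA2 o : measurable (A2 o) by case: o => [i|] //=; exact: measurableI.
have b0 o : 0 <= b o by case: o => [i|] /=; rewrite ?sqr_ge0 // mulr_ge0.
have c0 o : 0 <= c o by case: o => [i|] /=; rewrite ?sqr_ge0.
move=> /(_ mA1 mA2 b0 c0) H.
have {H} : ((P ^+ 2 * g + \sum_(i <- r) 2 * P * m i)%:E
   <= (P ^+ 2 + \sum_(i <- r) \sum_(j <- r) Q i j)%:E)%E.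
  apply: le_trans le2; apply: H => x.
  rewrite big2 /r1 big_cons big_map /=.
  set Z := \sum_(i <- r) \1_(A i) x : R.
  have -> : \sum_(i <- r) \sum_(j <- r) 1 * \1_(A i `&` A j) x = Z ^+ 2 :> R.
    rewrite expr2 mulr_suml; apply: eq_bigr => i _.
    rewrite mulr_sumr; apply: eq_bigr => j _.
    by rewrite mul1r indicI.
  rewrite -mulr_sumr -/Z.
  have [Gx|nGx] := boolP (x \in G).
    have -> : Z = 0.
      rewrite /Z big_seq big1 // => i ir; rewrite indicE.
      case: (boolP (x \in A i)) => // Ax; exfalso.
      have : (G `&` A i) x by split; apply: set_mem.
      by rewrite GA.
    rewrite mulr0 addr0 expr0n addr0 !indicE Gx (_ : x \in D) //.
    by apply/mem_set/GD/set_mem.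
  rewrite indicE (negbTE nGx) mulr0 add0r.
  have [Dx|nDx] := boolP (x \in D).
    rewrite indicE Dx mulr1 -subr_ge0.
    by apply: le_trans (sqr_ge0 (P - Z)) _; rewrite le_eqVlt; apply/orP; left; apply/eqP; ring.
  have -> : Z = 0.
    rewrite /Z big1 // => i _; rewrite indicE.
    case: (boolP (x \in A i)) => // Ax; exfalso; move/negP: nDx; apply.
    by apply/mem_set/(AD i)/set_mem.
  by rewrite mulr0 addr_ge0 ?mulr_ge0 ?sqr_ge0.
rewrite lee_fin -mulr_sumr -/P; lra.
Qed.

(** The measure is defined as an outer measure, which is monotone on all sets. *)
Lemma lebesgue_measureS (R : realType) (A B : set R) : A `<=` B ->
  (lebesgue_measure A <= lebesgue_measure B)%E.
Proof.
move=> AB; rewrite /lebesgue_measure /lebesgue_stieltjes_measure /measure_extension /=.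
exact: (@le_mu_ext _ _ R (wlength idfun) A B AB).
Qed.

(** * Hitting times of short intervals *)

Definition hit_set (R : realType) (c y : R) : set R :=
  [set x | 0 <= x < 1 /\ frac (x + c) < y].

Lemma hit_setE (R : realType) (c y : R) : 0 <= y <= 1 ->
  hit_set c y = if y <= frac c then `[1 - frac c, 1 - frac c + y[%classic
                else `[0, y - frac c[%classic `|` `[1 - frac c, 1[%classic.
Proof.
move=> /andP[y0 y1].
have c0 := frac_ge0 c; have c1 := frac_lt1 c.
have fxc (x : R) : frac (x + c) = frac (x + frac c).
  by rewrite [x + c]addrC [x + frac c]addrC fracDl.
rewrite /hit_set; apply/seteqP; split => x /=.
  move=> [/andP[x0 x1]]; rewrite fxc => h.
  have [lt1|ge1] := ltP (x + frac c) 1.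
    rewrite frac_id in h; last by apply/andP; split; lra.
    case: ifPn => h2; first by lra.
    by left; rewrite /= in_itv /=; apply/andP; split; lra.
  rewrite (@frac_eq _ _ 1) in h; last by apply/andP; split; lra.
  case: ifPn => h2; last by right; rewrite /= in_itv /=; apply/andP; split; lra.
  by rewrite /= in_itv /=; apply/andP; split; lra.
case: ifPn; rewrite -?ltNge => h2.
  rewrite /= in_itv /= => /andP[h3 h4]; split; first by apply/andP; split; lra.
  rewrite fxc (@frac_eq _ _ 1); first by lra.
  by apply/andP; split; lra.
rewrite /= !in_itv /= => -[] /andP[h3 h4].
  split; first by apply/andP; split; lra.
  by rewrite fxc frac_id; [lra|apply/andP; split; lra].
split; first by apply/andP; split; lra.
by rewrite fxc (@frac_eq _ _ 1); [lra|apply/andP; split; lra].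
Qed.

Lemma measurable_hit_set (R : realType) (c y : R) : 0 <= y <= 1 ->
  measurable (hit_set c y).
Proof.
by move=> y01; rewrite hit_setE //; case: ifP => _ //; exact: measurableU.
Qed.

Lemma measure_hit_set (R : realType) (c y : R) : 0 <= y <= 1 ->
  lebesgue_measure (hit_set c y) = y%:E.
Proof.
move=> y01; rewrite hit_setE //; move/andP: y01 => [y0 y1].
have c0 := frac_ge0 c; have c1 := frac_lt1 c.
have len (a b : R) : a <= b -> lebesgue_measure `[a, b[%classic = (b - a)%:E.
  move=> ab; rewrite lebesgue_measure_itv /= lte_fin; case: ltP => // h.
  by have -> : b = a by [apply/eqP; rewrite eq_le h ab]; rewrite subrr.
case: ifPn; rewrite -?ltNge => h.
  by rewrite len; [congr EFin; ring|lra].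
rewrite measureU //; last first.
  apply/seteqP; split => // x [] /=; rewrite !in_itv /= => /andP[? ?] /andP[? ?].
  lra.
rewrite /= !len; [|lra|lra].
by rewrite -EFinD; congr EFin; ring.
Qed.

(** At a common point, c' - c is the difference of the two fractional parts
    modulo 1. *)
Lemma hit_setI (R : realType) (c c' y y' : R) (x : R) :
  hit_set c y x -> hit_set c' y' x -> frac (c' - c + y) < y + y'.
Proof.
move=> [_ h] [_ h'].
have f0 := frac_ge0 (x + c); have f0' := frac_ge0 (x + c').
have -> : c' - c + y = (frac (x + c') - frac (x + c) + y)
   + (Num.floor (x + c') - Num.floor (x + c))%:~R.
  by rewrite rmorphB /= /frac; ring.
by rewrite fracDz; apply: le_lt_trans (frac_le_id _) _; lra.
Qed.

(** * Sums of reciprocals along the orbit *)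

Definition harm (R : realType) (T : nat) : R := \sum_(t < T) t.+1%:R^-1.

Lemma ln_le_harm (R : realType) (T : nat) : ln T.+1%:R <= harm R T.
Proof.
elim: T => [|T IH]; first by rewrite ln1 /harm big_ord0.
rewrite /harm big_ord_recr /= -/(harm R T).
have e : T.+2%:R = T.+1%:R * (1 + T.+1%:R^-1) :> R.
  by rewrite mulrDr mulr1 divff ?pnatr_eq0 // natr1.
have p : 0 < T.+1%:R^-1 :> R by rewrite invr_gt0 ltr0n.
rewrite e lnM ?posrE ?ltr0n ?addr_gt0 // lerD // le_ln1Dx //.
exact: lt_trans (ltrN10 _) p.
Qed.

Lemma harm_le (R : realType) (T : nat) : harm R T.+1 <= 1 + ln T.+1%:R.
Proof.
elim: T => [|T IH]; first by rewrite ln1 /harm big_ord1 invr1 addr0.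
rewrite /harm big_ord_recr /= -/(harm R T.+1).
have p : 0 < T.+2%:R^-1 :> R by rewrite invr_gt0 ltr0n.
have p1 : T.+2%:R^-1 < 1 :> R by rewrite invf_lt1 ?ltr0n // ltr1n.
have e : T.+1%:R = T.+2%:R * (1 - T.+2%:R^-1) :> R.
  by rewrite mulrBr mulr1 divff ?pnatr_eq0 // -[T.+2%:R]natr1 addrK.
have e1 : ln T.+1%:R = ln T.+2%:R + ln (1 - T.+2%:R^-1) :> R.
  by rewrite -lnM ?posrE ?ltr0n ?subr_gt0 // -e.
have p2 : -1 < - T.+2%:R^-1 :> R by rewrite ltrN2.
have e2 := le_ln1Dx p2; rewrite e1 in IH.
apply: (@le_trans _ _ (1 + (ln T.+2%:R + - T.+2%:R^-1) + T.+2%:R^-1)).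
  by rewrite lerD2r (le_trans IH) // lerD2l lerD2l.
by rewrite -addrA subrK.
Qed.

(** For z > 0 this is 1 / z rounded down, one less if 1 / z is an integer, and
    cut off at T. As a sum over thresholds it turns into hit counts when summed over
    an orbit. *)
Definition trunc_recip (R : realType) (T : nat) (z : R) : nat :=
  \sum_(t < T) (z < t.+1%:R^-1)%R.

Lemma trunc_recip_max (R : realType) T (z : R) : (trunc_recip T z <= T)%N.
Proof.
rewrite /trunc_recip -[leqRHS]card_ord -sum1_card; apply: leq_sum => t _.
exact: leq_b1.
Qed.

Lemma trunc_recip_le (R : realType) T (z : R) : 0 < z ->
  (trunc_recip T z)%:R <= z^-1.
Proof.
move=> z0; elim: T => [|T IH]; first by rewrite /trunc_recip big_ord0 invr_ge0 ltW.
have [h|h] := ltP z T.+1%:R^-1.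
  apply: (@le_trans _ _ T.+1%:R); first by rewrite ler_nat trunc_recip_max.
  by rewrite -[leLHS]invrK lef_pV2 ?posrE ?invr_gt0 ?ltr0n // ltW.
by rewrite /trunc_recip big_ord_recr /= (ltNge z) h /= addn0.
Qed.

Lemma trunc_recip_ge (R : realType) T (z : R) : 0 < z -> z^-1 <= T.+1%:R ->
  z^-1 <= (trunc_recip T z)%:R + 1.
Proof.
move=> z0; elim: T => [|T IH] h; first by rewrite /trunc_recip big_ord0 add0r.
have [h1|h1] := leP z^-1 T.+1%:R.
  by apply: le_trans (IH h1) _; rewrite lerD2r ler_nat /trunc_recip big_ord_recr /= leq_addr.
suff -> : trunc_recip T.+1 z = T.+1 by rewrite natr1.
rewrite /trunc_recip -[RHS]card_ord -sum1_card; apply: eq_bigr => t _.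
suff -> : z < t.+1%:R^-1 by [].
rewrite -[ltLHS]invrK ltf_pV2 ?posrE ?invr_gt0 ?ltr0n //.
by apply: le_lt_trans h1; rewrite ler_nat ltn_ord.
Qed.

(** Counting, for each t, the points below 1 / t turns the sum of the truncated
    reciprocals into a harmonic sum. *)
Lemma sum_trunc_recip (R : realType) (alpha x : R) (N T D : nat) :
  (forall y, 0 <= y <= 1 -> `|(hits alpha N x y)%:R - N%:R * y| <= D%:R) ->
  `|\sum_(n < N) (trunc_recip T (frac (x + n%:R * alpha)))%:R - N%:R * harm R T|
    <= T%:R * D%:R.
Proof.
move=> h.
have -> : \sum_(n < N) (trunc_recip T (frac (x + n%:R * alpha)))%:R
   = \sum_(t < T) (hits alpha N x t.+1%:R^-1)%:R :> R.
  rewrite -!natr_sum; congr (_%:R); rewrite exchange_big /=.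
  by apply: eq_bigr.
rewrite /harm mulr_sumr -sumrB (le_trans (ler_norm_sum _ _ _)) //.
have -> : T%:R * D%:R = \sum_(t < T) D%:R :> R.
  by rewrite sumr_const card_ord mulr_natl.
apply: ler_sum => t _.
by apply: h; rewrite invr_ge0 ler0n /= invf_le1 ?ltr0n // ler1n.
Qed.

Lemma rot_orbitE (R : realType) (alpha x : R) n : 0 <= x < 1 ->
  rot_orbit alpha x n = frac (x + n%:R * alpha).
Proof.
move=> x01; elim: n => [|n IH]; first by rewrite mul0r addr0 frac_id.
rewrite /rot_orbit iterS -/(rot_orbit alpha x n) IH.
rewrite -[LHS]/(frac (frac (x + n%:R * alpha) + alpha)) fracDl.
by rewrite -natr1 mulrDl mul1r addrA.
Qed.

Lemma birkhoff_recipE (R : realType) (alpha x : R) N : 0 <= x < 1 ->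
  birkhoff_sum alpha (@recip R) N x = \sum_(n < N) (frac (x + n%:R * alpha))^-1.
Proof. by move=> h; apply: eq_bigr => n _; rewrite rot_orbitE. Qed.

Lemma trimmed_le_birkhoff (R : realType) (alpha x : R) K N : 0 <= x < 1 ->
  trimmed_sum alpha (@recip R) K N x <= birkhoff_sum alpha (@recip R) N x.
Proof.
move=> x01.
have f0 n : 0 <= recip (rot_orbit alpha x n).
  by rewrite rot_orbitE // invr_ge0 frac_ge0.
rewrite /trimmed_sum; case: ifP => _; last by apply: sumr_ge0 => n _.
rewrite gerBl /largest_sum; set S := (X in sup X).
have [hS|hS] := pselect (has_sup S); last by rewrite sup_out.
have [[y Sy] _] := hS.
apply: le_trans (ub_le_sup _ Sy); last by case: hS.
by case: Sy => A _ <-; apply: sumr_ge0 => n _.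
Qed.

(** Minorize each term by w, except on C where the term itself is kept; this
    loses at most T for each index of C compared with adding the terms of C to
    the sum of w. The resulting minorant is at most T + M, so that K removed
    indices cost at most K (T + M). *)
Lemma trimmed_ge (R : realType) (alpha x : R) (K N : nat) (w : 'I_N -> R)
  (C : {set 'I_N}) (T M : R) : 0 <= x < 1 -> (K <= N)%N -> 0 <= T -> 0 <= M ->
  (forall n, w n <= (frac (x + n%:R * alpha))^-1) ->
  (forall n, w n <= T) ->
  (forall n, n \in C -> (frac (x + n%:R * alpha))^-1 <= M) ->
  \sum_n w n - #|C|%:R * T + \sum_(n in C) (frac (x + n%:R * alpha))^-1
    - K%:R * (T + M) <= trimmed_sum alpha (@recip R) K N x.
Proof.
move=> x01 KN T0 M0 wv wT CM.
pose v (n : 'I_N) := (frac (x + n%:R * alpha))^-1.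
pose w' n := if n \in C then v n else w n.
have w'v n : w' n <= v n by rewrite /w'; case: ifP => // _; exact: wv.
have w'TM n : w' n <= T + M.
  rewrite /w'; case: ifPn => [/CM|_]; first by rewrite /v; lra.
  by have := wT n; lra.
have e : \sum_n w n - #|C|%:R * T + \sum_(n in C) v n <= \sum_n w' n.
  rewrite [X in X - _](bigID (mem C)) [leRHS](bigID (mem C)) /=.
  have -> : \sum_(n in C) w' n = \sum_(n in C) v n.
    by apply: eq_bigr => n nC; rewrite /w' nC.
  have -> : \sum_(n | n \notin C) w' n = \sum_(n | n \notin C) w n.
    by apply: eq_bigr => n nC; rewrite /w' (negbTE nC).
  have : \sum_(n in C) w n <= \sum_(n in C) T by apply: ler_sum.
  by rewrite sumr_const mulr_natl; lra.
rewrite /trimmed_sum KN birkhoff_recipE // /largest_sum.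
have trim (A : {set 'I_N}) : #|A| = K ->
    \sum_(n in A) v n <= \sum_n v n - (\sum_n w' n - K%:R * (T + M)).
  move=> AK.
  rewrite [\sum_n v n](bigID (mem A)) [\sum_n w' n](bigID (mem A)) /=.
  have h1 : \sum_(n in A) w' n <= \sum_(n in A) (T + M) by apply: ler_sum.
  rewrite sumr_const AK -mulr_natl in h1.
  have h2 : \sum_(n | n \notin A) w' n <= \sum_(n | n \notin A) v n by apply: ler_sum.
  lra.
have sup_le : largest_sum alpha (@recip R) K N x
    <= \sum_n v n - (\sum_n w' n - K%:R * (T + M)).
  apply: ge_sup.
    pose A : {set 'I_N} := finset (fun i : 'I_N => (i < K)%N).
    exists (\sum_(n in A) recip (rot_orbit alpha x n)), A => //=.
    have winj : injective (widen_ord KN) by move=> i j /(congr1 val) /= ij; exact: val_inj.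
    rewrite -[RHS](card_ord K) -(card_imset _ winj).
    apply: eq_card => i; rewrite inE; apply/idP/imsetP => [iK|[j _ ->]] //=.
    by exists (Ordinal iK) => //; exact: val_inj.
  move=> _ [A AK <-]; apply: le_trans (trim A AK).
  by under eq_bigr do rewrite rot_orbitE //.
rewrite /largest_sum in sup_le; rewrite -/v /v in e sup_le *; lra.
Qed.

(** Set to 0 at 0, so as to stay below the reciprocal, whose value at 0 is 0. *)
Definition cut_recip (R : realType) (T : nat) (z : R) : R :=
  if z == 0 then 0 else (trunc_recip T z)%:R.

Lemma cut_recip_le (R : realType) T (z : R) : 0 <= z -> cut_recip T z <= z^-1.
Proof.
rewrite /cut_recip le_eqVlt => /orP[/eqP <-|z0]; first by rewrite eqxx invr0.
by rewrite gt_eqF // trunc_recip_le.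
Qed.

Lemma cut_recip_max (R : realType) T (z : R) : cut_recip T z <= T%:R.
Proof.
by rewrite /cut_recip; case: ifP => _; rewrite ?ler0n // ler_nat trunc_recip_max.
Qed.

(** With T = N / D the discrepancy only costs O(N), and passing from ln N to
    ln T costs ln D per point. *)
Lemma sum_cut_recip_ge (R : realType) (alpha x : R) (N D : nat) :
  (0 < N)%N -> (0 < D)%N ->
  (forall y, 0 <= y <= 1 -> `|(hits alpha N x y)%:R - N%:R * y| <= D%:R) ->
  N%:R * ln N%:R - N%:R * (ln D%:R + 3)
    <= \sum_(n < N) cut_recip (N %/ D) (frac (x + n%:R * alpha)).
Proof.
move=> N0 D0 h; set T := (N %/ D)%N.
have TD : (T * D <= N)%N by exact: leq_divM.
have TN : (T <= N)%N by exact: leq_div.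
have NTD : (N < T.+1 * D)%N by rewrite -ltn_divLR.
have N0R : 0 < N%:R :> R by rewrite ltr0n.
pose zeros : R := (hits alpha N x N%:R^-1)%:R.
have Z : zeros <= D%:R + 1.
  have := h N%:R^-1; rewrite invr_ge0 ler0n invf_le1 // ler1n N0 => /(_ isT).
  by rewrite divff ?gt_eqF // ler_norml => /andP[_]; rewrite /zeros; lra.
have S : \sum_(n < N) (trunc_recip T (frac (x + n%:R * alpha)))%:R - T%:R * zeros
    <= \sum_(n < N) cut_recip T (frac (x + n%:R * alpha)).
  rewrite /zeros /hits natr_sum mulr_sumr -sumrB; apply: ler_sum => n _.
  rewrite /cut_recip; case: ifP => [/eqP ->|_]; last by rewrite gerBl mulr_ge0.
  rewrite invr_gt0 N0R mulr1 subr_le0 ler_nat; exact: trunc_recip_max.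
have := sum_trunc_recip T h; rewrite ler_norml => /andP[L _].
have lnN : ln N%:R <= harm R T + ln D%:R.
  apply: (@le_trans _ _ (ln (T.+1 * D)%:R)).
    by rewrite ler_ln ?posrE ?ltr0n ?muln_gt0 // ler_nat ltnW.
  by rewrite natrM lnM ?posrE ?ltr0n // lerD2r ln_le_harm.
have lnN' : N%:R * ln N%:R <= N%:R * (harm R T + ln D%:R) by rewrite ler_pM2l.
have TDR : T%:R * D%:R <= N%:R :> R by rewrite -natrM ler_nat.
have TNR : T%:R <= N%:R :> R by rewrite ler_nat.
have TZ : T%:R * zeros <= T%:R * (D%:R + 1) by rewrite ler_wpM2l.
rewrite !mulrDr in lnN' TZ *; lra.
Qed.

(** The truncation is within 1 of the reciprocal down to 1 / (T + 1); only the
    closer points remain to be controlled. *)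
Lemma sum_recip_le (R : realType) (alpha x : R) (N D : nat) :
  (0 < N)%N -> (0 < D)%N ->
  (forall y, 0 <= y <= 1 -> `|(hits alpha N x y)%:R - N%:R * y| <= D%:R) ->
  \sum_(n < N) (frac (x + n%:R * alpha))^-1
   <= N%:R * ln N%:R + 3 * N%:R
    + \sum_(n < N | frac (x + n%:R * alpha) < (N %/ D).+1%:R^-1)
         (frac (x + n%:R * alpha))^-1.
Proof.
move=> N0 D0 h; set T := (N %/ D)%N.
have TD : (T * D <= N)%N by exact: leq_divM.
have TN : (T <= N)%N by exact: leq_div.
have N0R : 0 < N%:R :> R by rewrite ltr0n.
have TDR : T%:R * D%:R <= N%:R :> R by rewrite -natrM ler_nat.
have lnN0 : 0 <= ln N%:R :> R by rewrite ln_ge0 // ler1n.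
have HT : harm R T <= 1 + ln N%:R.
  move: TN; case: (T) => [|t] tN; first by rewrite /harm big_ord0 addr_ge0.
  by apply: (le_trans (harm_le _ _)); rewrite lerD2l ler_ln ?posrE ?ltr0n // ler_nat.
have HT' : N%:R * harm R T <= N%:R * (1 + ln N%:R) by rewrite ler_pM2l.
have := sum_trunc_recip T h; rewrite ler_norml => /andP[_ U].
rewrite [leLHS](bigID (fun n : 'I_N => frac (x + n%:R * alpha) < T.+1%:R^-1)) /=.
rewrite addrC lerD2r.
apply: (@le_trans _ _ (\sum_(n < N) ((trunc_recip T (frac (x + n%:R * alpha)))%:R + 1))).
  rewrite [leRHS](bigID (fun n : 'I_N => frac (x + n%:R * alpha) < T.+1%:R^-1)) /=.
  apply: ler_wpDl; first by apply: sumr_ge0 => n _; rewrite addr_ge0.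
  apply: ler_sum => n; rewrite -leNgt => ge.
  have p : 0 < T.+1%:R^-1 :> R by rewrite invr_gt0 ltr0n.
  have f0 := lt_le_trans p ge.
  apply: trunc_recip_ge => //.
  by rewrite -[leRHS]invrK lef_pV2 ?posrE.
rewrite big_split /= sumr_const card_ord mulr_natr.
rewrite mulrDr mulr1 in HT'; lra.
Qed.

(** A dyadic staircase above the reciprocal: step j has height 2^(j+1) / b and
    width b / 2^j, so each of the J scales contributes 2 to the integral. *)
Lemma recip_le_dyadic (R : realType) (b z : R) (J : nat) :
  0 < b -> b / 2 ^+ J <= z -> z < b ->
  z^-1 <= \sum_(j < J) (2 ^+ j.+1 / b) * (z < b / 2 ^+ j)%R%:R.
Proof.
move=> b0; elim: J => [|J IH] h1 h2; first by move: h1; rewrite expr0 divr1; lra.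
rewrite big_ord_recr /=; have [h|h] := ltP z (b / 2 ^+ J); last first.
  by rewrite mulr0 addr0 IH.
rewrite mulr1; apply: ler_wpDl.
  by apply: sumr_ge0 => j _; rewrite mulr_ge0 // divr_ge0 ?exprn_ge0 // ltW.
have p : 0 < b / 2 ^+ J.+1 by rewrite divr_gt0 // exprn_gt0.
by rewrite -[leRHS]invrK lef_pV2 ?posrE ?(lt_le_trans p) ?invf_div.
Qed.

(** For even n the error is delta = q_n alpha - p_n, so steps of length q_n move
    a point up by delta. The hypothesis puts the point at time i within m delta
    below an integer; it crosses this integer within m steps, first landing at
    some u < delta. *)
Lemma cluster (R : realType) a (alpha x : R) (n i m : nat) :
  ~~ odd n -> 0 < cf_err a alpha n -> m.+1%:R * cf_err a alpha n <= 1 ->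
  frac (x + i%:R * alpha + m%:R * cf_err a alpha n) < m%:R * cf_err a alpha n ->
  exists (u : R) (k0 : nat), [/\ 0 <= u < cf_err a alpha n, (k0 <= m)%N &
    forall k, (k <= m)%N ->
      frac (x + (i + (k0 + k) * cf_den a n)%N%:R * alpha)
        = u + k%:R * cf_err a alpha n].
Proof.
move=> en; have de : cf_err a alpha n = (cf_den a n)%:R * alpha - (cf_num a n)%:R.
  by rewrite /cf_err -signr_odd (negbTE en) mul1r.
set d := cf_err a alpha n in de * => d0 md.
set z := x + _ + _; set s := frac z => sm.
have s0 : 0 <= s := frac_ge0 z.
have [l ll lr] : exists2 l : nat, l%:R * d <= s & s < l.+1%:R * d.
  exists (Num.truncn (s / d)).
    by rewrite -ler_pdivlMr // truncn_le // divr_ge0 // ltW.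
  by rewrite -ltr_pdivrMr // truncnS_gt.
have {}lr : s < l%:R * d + d by move: lr; rewrite -natr1 mulrDl mul1r.
have lm : (l < m)%N.
  rewrite -(ltr_nat R) -(ltr_pM2r d0); exact: le_lt_trans ll sm.
exists (s - l%:R * d), (m - l)%N; split.
- by rewrite subr_ge0 ll /= ltrBlDl.
- exact: leq_subr.
move=> k km.
have key : x + (i + (m - l + k) * cf_den a n)%N%:R * alpha
   = (s - l%:R * d + k%:R * d)
     + (Num.floor z + ((m - l + k) * cf_num a n)%N%:Z)%:~R.
  have es : s = z - (Num.floor z)%:~R by [].
  rewrite es /z intrD -pmulrn !natrD !natrM !natrD !natrB ?(ltnW lm) // de.
  by ring.
rewrite key fracDz frac_id //; apply/andP; split.
  by rewrite addr_ge0 ?subr_ge0 // mulr_ge0 // ltW.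
apply: lt_le_trans md.
rewrite -natr1 mulrDl mul1r [ltRHS]addrC ltr_leD //.
  by rewrite ltrBlDl.
by rewrite ler_pM2r // ler_nat.
Qed.

(** * The rotation number *)

(** Two requirements meet here. The partial quotients a_n must exceed the number
    2^n of steps in a window by a factor whose inverse has a divergent sum, and
    ln a_n must be small against ln q_n while the quotients grow. With the factor
    n + 1, ln a_n is of order n and ln q_n of order n^2. *)
Definition quot (k : nat) : nat := (k.+1 * 2 ^ k)%N.

Lemma quot_gt0 k : (0 < quot k)%N.
Proof. by rewrite muln_gt0 expn_gt0. Qed.

Lemma cf_den_quot_le n : (cf_den quot n <= 2 ^ (n ^ 2))%N.
Proof.
elim: n => [//|n IH]; apply: (leq_trans (cf_den_leM n quot_gt0)).
have -> : (n.+1 ^ 2 = n ^ 2 + (n + n + 1))%N by rewrite -!mulnn; lia.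
rewrite expnD mulnC leq_mul // !expnD /quot.
have : (n < 2 ^ n)%N by exact: ltn_expl.
by move: (2 ^ n)%N => w; nia.
Qed.

Lemma cf_den_quot_ge n : (2 ^ (n ^ 2) <= cf_den quot n ^ 2 * 2 ^ n)%N.
Proof.
elim: n => [//|n IH].
have -> : (n.+1 ^ 2 = n ^ 2 + (n + n + 1))%N by rewrite -!mulnn; lia.
have h : (2 ^ n * cf_den quot n <= cf_den quot n.+1)%N.
  by apply: leq_trans (cf_den_geM quot n); rewrite leq_mul // /quot leq_pmull.
rewrite !expnD [(2 ^ n.+1)%N]expnS.
have : ((2 ^ n * cf_den quot n) ^ 2 <= cf_den quot n.+1 ^ 2)%N by rewrite leq_exp2r.
move: IH; rewrite !expnMn -!mulnn.
move: (2 ^ (n * n))%N (2 ^ n)%N (cf_den quot n) (cf_den quot n.+1) => A w q q' IH h2.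
rewrite expn1.
have h3 := leq_mul IH (leqnn (w * w * 2)); have h4 := leq_mul h2 (leqnn (w * 2)).
lia.
Qed.

Lemma discr_gt0 n : (0 < discr quot n.+1)%N.
Proof. by rewrite /discr muln_gt0 /= big_ord_recl /= addn_gt0 quot_gt0. Qed.

Lemma discr_quot_le n : (discr quot n.+1 <= 2 ^ (n + n + 3))%N.
Proof.
have h : (discr quot n.+1 <= 3 * (n.+1 * 2 ^ n.+1))%N.
  rewrite /discr leq_mul2l /=; elim: n => [|n IH]; first by rewrite big_ord1.
  rewrite big_ord_recr /=; apply: (leq_trans (leq_add IH (leqnn _))).
  by rewrite /quot !expnS; move: (2 ^ n)%N => w; nia.
apply: (leq_trans h); rewrite !expnD expnS.
have : (n < 2 ^ n)%N by exact: ltn_expl.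
by move: (2 ^ n)%N => w; nia.
Qed.

Lemma ln2_bounds (R : realType) : 2^-1 <= ln 2 :> R /\ ln 2 <= 1 :> R.
Proof.
split; last first.
  have -> : 2 = 1 + 1 :> R by ring.
  by apply: le_ln1Dx; lra.
have h : -1 < - 2^-1 :> R by lra.
have := le_ln1Dx h; have -> : 1 + - 2^-1 = 2^-1 :> R by lra.
rewrite lnV ?posrE //; lra.
Qed.

Lemma ln_pow2 (R : realType) k : ln (2 ^ k)%N%:R = k%:R * ln 2 :> R.
Proof. by rewrite natrX lnXn // mulr_natl. Qed.

Lemma ln_cf_den_le (R : realType) n :
  ln (cf_den quot n)%:R <= n%:R ^+ 2 * ln 2 :> R.
Proof.
apply: (@le_trans _ _ (ln ((2 ^ (n ^ 2))%N)%:R)).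
  by rewrite ler_ln ?posrE ?ltr0n ?cf_den_gt0 ?expn_gt0 // ?ler_nat ?cf_den_quot_le //; exact: quot_gt0.
by rewrite ln_pow2 natrX.
Qed.

Lemma ln_cf_den_ge (R : realType) n :
  (n%:R ^+ 2 - n%:R) / 2 * ln 2 <= ln (cf_den quot n)%:R :> R.
Proof.
have q0 : 0 < (cf_den quot n)%:R :> R by rewrite ltr0n cf_den_gt0 //; exact: quot_gt0.
have : ln ((2 ^ (n ^ 2))%N)%:R <= ln ((cf_den quot n ^ 2 * 2 ^ n)%N)%:R :> R.
  rewrite ler_ln ?posrE ?ltr0n ?muln_gt0 ?expn_gt0 ?ler_nat ?cf_den_quot_ge //.
  by rewrite cf_den_gt0 //; exact: quot_gt0.
rewrite natrM lnM ?posrE ?ltr0n ?expn_gt0 ?cf_den_gt0 //; last exact: quot_gt0.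
rewrite !ln_pow2 [(cf_den quot n ^ 2)%:R]natrX lnXn // natrX -(mulr_natl (ln _)); lra.
Qed.

Lemma ln_discr_le (R : realType) n :
  ln (discr quot n.+1)%:R <= (2 * n%:R + 3) * ln 2 :> R.
Proof.
have D0 := discr_gt0 n.
apply: (@le_trans _ _ (ln ((2 ^ (n + n + 3))%N)%:R)).
  by rewrite ler_ln ?posrE ?ltr0n ?expn_gt0 // ler_nat discr_quot_le.
by rewrite ln_pow2 !natrD; lra.
Qed.

(** From this distance below 1, at most 2^n steps of length q_n lead across 0
    when n is even. *)
Definition window (R : realType) (alpha : R) (n : nat) : R :=
  (2 ^ n)%N%:R * cf_err quot alpha n.

(** The arithmetic of the next lemma, with x = ln N, y = ln D, q = q_{n+1} and
    l = ln 2; w is the bulk and c the contribution of the cluster. Since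
    q >= (n + 1) N / 3, the cluster adds about n (n + 1) l N / 3, against
    N x <= (n + 1)^2 l N: a gain of about one third, of which one sixth is kept
    and the rest absorbs the terms of order n N and K n N. *)
Lemma cluster_gain (R : realFieldType) (K n l N x y q T m w c : R) :
  0 <= K -> 24 * K + 100 <= n -> 2^-1 <= l -> l <= 1 -> 0 <= N ->
  x <= (n + 1) ^+ 2 * l -> y <= (2 * n + 3) * l -> T <= N -> m * T <= N ->
  (n + 1) * N <= 3 * q -> N * x - N * (y + 3) <= w -> q * (n * l - 1) <= c ->
  (1 + 6^-1) * (N * x) <= w - m * T + c - K * (T + 2 * q).
Proof.
move=> K0 nK l1 l2 N0 xl yl TN mTN Nq bulk cl.
have g0 : 0 <= n * l - 1 - 2 * K.
  have : 0 <= n * (l - 2^-1) by rewrite mulr_ge0; lra.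
  lra.
have g1 : (n + 1) * N * (n * l - 1 - 2 * K) <= 3 * q * (n * l - 1 - 2 * K).
  by rewrite ler_wpM2r.
have b1 : N * y <= N * ((2 * n + 3) * l) by rewrite ler_wpM2l.
have b2 : N * x <= N * ((n + 1) ^+ 2 * l) by rewrite ler_wpM2l.
have KT : K * T <= K * N by rewrite ler_wpM2l.
have num : (n + 1) ^+ 2 * l / 6 + (2 * n + 3) * l + 4 + K
    <= (n + 1) * (n * l - 1 - 2 * K) / 3.
  have h : 0 <= (n + 1) * (n - 1 - 24 * K - 99) by rewrite mulr_ge0; lra.
  have h' : 0 <= (n + 1) * (n - 1) * (l - 2^-1) by rewrite !mulr_ge0; lra.
  have h2 : 0 <= (n + 1) * (1 - l) by rewrite mulr_ge0; lra.
  have h3 : 0 <= (n + 1) * K by rewrite mulr_ge0 //; lra.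
  rewrite !mulrDl !mulrDr expr2 in h h' h2 h3 *.
  lra.
have num' : N * ((n + 1) ^+ 2 * l / 6 + (2 * n + 3) * l + 4 + K)
    <= N * ((n + 1) * (n * l - 1 - 2 * K) / 3) by rewrite ler_wpM2l.
rewrite !expr2 in num' b2; lra.
Qed.

(** The window brings a cluster of 2^n points u + k delta, 1 <= k <= 2^n, before
    time N. Their reciprocals add up to about q_{n+1} ln (2^n) without any of
    them exceeding 2 q_{n+1}, which is why trimming a fixed number of terms is
    harmless. *)
Lemma trimmed_large (R : realType) (alpha x : R) (K n i N : nat) :
  (forall k, 0 < cf_err quot alpha k) -> ~~ odd n -> (24 * K + 100 <= n)%N ->
  (i < cf_den quot n)%N ->
  hit_set (i%:R * alpha + window alpha n) (window alpha n) x ->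
  N = ((2 ^ n + 2 ^ n + 1) * cf_den quot n)%N ->
  (1 + 6^-1) * (N%:R * ln N%:R) <= trimmed_sum alpha (@recip R) K N x.
Proof.
move=> herr en nK iq [x01 hx]; set q := cf_den quot n in iq * => eN.
 set q' := cf_den quot n.+1.
set m := (2 ^ n)%N in eN *; set d := cf_err quot alpha n.
have q0 : (0 < q)%N by rewrite cf_den_gt0 //; exact: quot_gt0.
have d0 : 0 < d := herr n.
have nm : (n < m)%N by exact: ltn_expl.
have m0 : (0 < m)%N by exact: leq_ltn_trans nm.
have qq : (n.+1 * m * q <= q')%N by exact: cf_den_geM.
have q'0 : (0 < q')%N by rewrite cf_den_gt0 //; exact: quot_gt0.
have d1 : q'%:R * d <= 1 by exact: cf_err_le quot_gt0 herr.
have d2 : 1 <= 2 * (q'%:R * d) by exact: cf_err_ge quot_gt0 herr.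
have md : m.+1%:R * d <= 1.
  apply: le_trans d1; rewrite ler_pM2r // ler_nat.
  by apply: leq_trans qq; nia.
have Nq' : (N < q')%N by apply: leq_trans qq; rewrite eN; nia.
have N0 : (0 < N)%N by rewrite eN; nia.
have KN : (K <= N)%N by rewrite eN; nia.
set D := discr quot n.+1.
have D0 : (0 < D)%N := discr_gt0 n.
have hD y : 0 <= y <= 1 -> `|(hits alpha N x y)%:R - N%:R * y| <= D%:R.
  exact: hits_discr quot_gt0 herr Nq'.
have mD : (m <= D)%N.
  rewrite /D /discr big_ord_recr /= mulnDr; apply: leq_trans (leq_addl _ _).
  by rewrite /quot -/m; nia.
set T := (N %/ D)%N.
have TD : (T * D <= N)%N by exact: leq_divM.
have TN : (T <= N)%N by exact: leq_div.
rewrite addrA in hx.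
have [u [k0 [/andP[u0 ud] k0m visits]]] := cluster en d0 md hx.
rewrite -/q -/d in ud visits.
have ctime (k : 'I_m) : (i + (k0 + k.+1) * q < N)%N.
  rewrite eN [((_ + 1) * q)%N]mulnDl mul1n [ltnRHS]addnC -addSn leq_add // leq_mul2r.
  by rewrite leq_add ?orbT // ltn_ord.
pose c (k : 'I_m) : 'I_N := Ordinal (ctime k).
have cinj : injective c.
  move=> k l /(congr1 val) /= /addnI /eqP; rewrite eqn_pmul2r // => /eqP /addnI [].
  exact: val_inj.
have cval k : (frac (x + (c k)%:R * alpha))^-1 = (u + k.+1%:R * d)^-1.
  by rewrite /= visits.
have inv_d : q'%:R <= d^-1 by rewrite -[leRHS]mul1r ler_pdivlMr.
have inv_d2 : d^-1 <= 2 * q'%:R by rewrite -[leLHS]mul1r ler_pdivrMr // -mulrA.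
have := @trimmed_ge R alpha x K N
  (fun k => cut_recip T (frac (x + k%:R * alpha))) (c @: [set: 'I_m])%SET
  T%:R (2 * q'%:R) x01 KN (ler0n _ _).
have M0 : 0 <= 2 * q'%:R :> R by rewrite mulr_ge0.
move=> /(_ M0) H.
have {H} := H (fun k => cut_recip_le T (frac_ge0 _)) (fun k => cut_recip_max T _).
have CM k : k \in (c @: [set: 'I_m])%SET ->
    (frac (x + k%:R * alpha))^-1 <= 2 * q'%:R.
  move=> /imsetP[l _ ->]; rewrite cval; apply: le_trans inv_d2.
  rewrite lef_pV2 ?posrE //; last by rewrite ltr_wpDl // mulr_gt0.
  by apply: ler_wpDl => //; rewrite -[leLHS]mul1r ler_pM2r // ler1n.
move=> /(_ CM).
rewrite card_imset // cardsT card_ord.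
have cl : q'%:R * (ln m%:R - 1)
    <= \sum_(k in (c @: [set: 'I_m])%SET) (frac (x + k%:R * alpha))^-1.
  rewrite big_imset /=; last by move=> k l _ _; exact: cinj.
  apply: (@le_trans _ _ (\sum_(k < m) q'%:R * k.+2%:R^-1)).
    rewrite -mulr_sumr ler_pM2l ?ltr0n // lerBlDl.
    have : ln m.+2%:R <= harm R m.+1 by exact: ln_le_harm.
    rewrite /harm big_ord_recl /= invr1; apply: le_trans.
    by rewrite ler_ln ?posrE ?ltr0n // ler_nat; apply: leqW.
  rewrite [leRHS](eq_bigl xpredT); last by move=> k; rewrite inE.
  apply: ler_sum => k _; rewrite visits //.
  apply: (@le_trans _ _ (d^-1 * k.+2%:R^-1)); first by rewrite ler_pM2r ?invr_gt0.
  have uk0 : 0 < u + k.+1%:R * d by rewrite ltr_wpDl // (mulr_gt0 _ d0).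
  have dk0 : 0 < d * k.+2%:R by rewrite (mulr_gt0 d0).
  rewrite -invfM lef_pV2 ?posrE //.
  have -> : d * k.+2%:R = d + k.+1%:R * d by rewrite -[k.+2%:R]natr1; ring.
  by rewrite lerD2r ltW.
have bulk := @sum_cut_recip_ge R alpha x N D N0 D0 hD.
rewrite -/T in bulk.
have lnN : ln N%:R <= (n%:R + 1) ^+ 2 * ln 2 :> R.
  rewrite natr1; apply: le_trans (ln_cf_den_le R n.+1).
  by rewrite ler_ln ?posrE ?ltr0n // ler_nat ltnW.
have [l1 l2] := ln2_bounds R.
apply: le_trans; apply: (@cluster_gain R K%:R n%:R (ln 2) N%:R (ln N%:R) (ln D%:R)) => //.
- by rewrite -natrM -natrD ler_nat.
- exact: ln_discr_le.
- by rewrite ler_nat.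
- by rewrite -natrM ler_nat; apply: leq_trans TD; rewrite mulnC leq_mul.
- rewrite natr1 -!natrM ler_nat; apply: (@leq_trans (3 * (n.+1 * m * q))%N).
    rewrite eN -mulnA [leqRHS]mulnCA leq_mul // mulnA leq_mul2r; apply/orP; right.
    by rewrite 2!mulSn mul1n addnA leq_add2l.
  by rewrite leq_mul.
- by rewrite -ln_pow2.
Qed.

(** * Convergence in measure *)

Lemma sum_iota (R : realType) (F : nat -> R) N :
  \sum_(k <- iota 0 N) F k = \sum_(k < N) F k.
Proof. by rewrite -(big_mkord xpredT) /index_iota subn0. Qed.

Lemma markov_indic (d : measure_display) (T : measurableType d)
  (R : realType) (mu : {measure set T -> \bar R}) (I : Type) (r : seq I)
  (b m : I -> R) (A : I -> set T) (t : R) : 0 < t ->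
  (forall i, measurable (A i)) -> (forall i, 0 <= b i) ->
  (forall i, mu (A i) = (m i)%:E) ->
  let G := [set x | t < \sum_(i <- r) b i * \1_(A i) x] in
  measurable G /\ (mu G <= ((\sum_(i <- r) b i * m i) / t)%:E)%E.
Proof.
move=> t0 mA b0 mum G.
have mG : measurable G.
  have mf : measurable_fun setT (fun x => \sum_(i <- r) b i * \1_(A i) x).
    by apply: measurable_sum => i; exact: measurable_funM.
  have -> : G = setT `&` (fun x => \sum_(i <- r) b i * \1_(A i) x) @^-1` `]t, +oo[%classic.
    by rewrite setTI; apply/seteqP; split => x /=; rewrite in_itv /= andbT.
  exact: mf.
split=> //.
have := @weighted_measure_le _ _ _ mu _ _ [:: tt] r (fun=> t) b (fun=> G) A.
rewrite big_seq1 => H.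
have {}H : (t%:E * mu G <= (\sum_(i <- r) b i * m i)%:E)%E.
  have -> : (\sum_(i <- r) b i * m i)%:E = (\sum_(i <- r) (b i)%:E * mu (A i))%E.
    by rewrite -sumEFin; apply: eq_bigr => i _; rewrite mum.
  apply: H => // [_|x]; first exact: ltW.
  rewrite big_seq1 indicE; have [xG|xG] := boolP (x \in G).
    by rewrite mulr1 ltW //; exact: set_mem xG.
  by rewrite mulr0 sumr_ge0 // => i _; rewrite mulr_ge0.
by rewrite mulrC EFinM lee_pdivlMl.
Qed.

Lemma weak_law_numeric (R : realFieldType) (n l L y : R) :
  10 <= n -> 2^-1 <= l -> (n ^+ 2 - n) / 2 * l <= L -> y <= (2 * n + 3) * l ->
  [/\ 0 < L, y + 3 <= 12 / n * L, 3 <= 12 / n * L &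
      2 * (3 * n + 4) <= 56 / n * L].
Proof.
move=> n10 l0 hL hy.
have n0 : 0 < n by lra.
have h1 : (n - 1) / 2 * l <= L / n.
  rewrite ler_pdivlMr //; apply: le_trans hL.
  by rewrite le_eqVlt; apply/orP; left; apply/eqP; ring.
have h2 : (n - 1) * 2^-1 <= (n - 1) * l by rewrite ler_wpM2l //; lra.
have h3 : 10 * l <= n * l by rewrite ler_wpM2r //; lra.
have e c : c / n * L = c * (L / n) by ring.
have e2 : 0 < L / n by lra.
rewrite !e; split; [by move: e2; rewrite pmulr_lgt0 ?invr_gt0| | |]; lra.
Qed.

(** By sum_cut_recip_ge and sum_recip_le only the terms above T + 1, where
    T = N / D, can spoil the estimate. The exceptional set consists of two parts:
    some point is closer than 1 / (2^J (T + 1)) to 0, or the dyadic staircase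
    over J scales is large. With J of order n the staircase has mean of order
    n N against N ln N of order n^2 N. *)
Lemma weak_law_block (R : realType) (alpha : R) (n N : nat) (eta : R) :
  (forall k, 0 < cf_err quot alpha k) -> (10 <= n)%N -> 0 < eta ->
  (cf_den quot n <= N < cf_den quot n.+1)%N ->
  exists U : set R, [/\ measurable U,
    (lebesgue_measure U <= ((1 + 56 / eta) / n%:R)%:E)%E &
    forall x, 0 <= x < 1 -> ~ U x ->
      `|birkhoff_sum alpha (@recip R) N x / (N%:R * ln N%:R) - 1|
        <= eta + 12 / n%:R].
Proof.
move=> herr n10 eta0 /andP[qN Nq].
have N0 : (0 < N)%N by apply: leq_trans qN; rewrite cf_den_gt0 //; exact: quot_gt0.
have N0R : 0 < N%:R :> R by rewrite ltr0n.
set D := discr quot n.+1; have D0 : (0 < D)%N := discr_gt0 n.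
have hD x y : 0 <= y <= 1 -> `|(hits alpha N x y)%:R - N%:R * y| <= D%:R.
  exact: hits_discr quot_gt0 herr Nq.
have [l1 l2] := ln2_bounds R.
have lnN : (n%:R ^+ 2 - n%:R) / 2 * ln 2 <= ln N%:R :> R.
  apply: (le_trans (ln_cf_den_ge R n)); rewrite ler_ln ?posrE ?ltr0n ?ler_nat //.
  by rewrite cf_den_gt0 //; exact: quot_gt0.
have n10R : 10 <= n%:R :> R by rewrite ler_nat.
have n0R : 0 < n%:R :> R by lra.
have [L0 err1 err2 err3] := weak_law_numeric n10R l1 lnN (ln_discr_le R n).
have NL0 : 0 < N%:R * ln N%:R :> R by rewrite mulr_gt0.
set T := (N %/ D)%N; pose bb : R := T.+1%:R^-1; pose J := (3 * n + 4)%N.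
have bb0 : 0 < bb by rewrite invr_gt0 ltr0n.
have bb1 : bb <= 1 by rewrite invf_le1 ?ltr0n // ler1n.
have step01 j : 0 <= bb / 2 ^+ j <= 1.
  have p : 1 <= 2 ^+ j :> R by rewrite exprn_ege1 //; lra.
  have p' : 0 < 2 ^+ j :> R by lra.
  by rewrite divr_ge0 ?(ltW bb0) ?(ltW p') //= ler_pdivrMr // mul1r; lra.
(* The index (k, j) stands for step j of the staircase at time k. *)
pose r := [seq (k, j) | k <- iota 0 N, j <- iota 0 J].
pose b (kj : nat * nat) : R := 2 ^+ kj.2.+1 / bb.
pose m (kj : nat * nat) : R := bb / 2 ^+ kj.2.
pose A (kj : nat * nat) := hit_set (kj.1%:R * alpha) (m kj).
have b0 kj : 0 <= b kj by rewrite divr_ge0 ?exprn_ge0 // ltW.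
have mA kj : measurable (A kj) by apply: measurable_hit_set; exact: step01.
have muA kj : lebesgue_measure (A kj) = (m kj)%:E by apply: measure_hit_set; exact: step01.
have [mG2 G2] := markov_indic (mu := @lebesgue_measure R) r (mulr_gt0 eta0 NL0) mA b0 muA.
pose A' (k : nat) := hit_set (k%:R * alpha) (bb / 2 ^+ J).
have mA' k : measurable (A' k) by exact: measurable_hit_set.
have muA' k : lebesgue_measure (A' k) = (bb / 2 ^+ J)%:E by exact: measure_hit_set.
(* The number of points closer than bb / 2^J is an integer, so exceeding 1/2
   means that there is one. *)
have half0 : 0 < 2^-1 :> R by lra.
have [mG1 G1] := markov_indic (mu := @lebesgue_measure R) (iota 0 N) half0 mA' (fun=> ler01) muA'.
set g1 := [set x | _] in mG1 G1; set g2 := [set x | _] in mG2 G2.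
exists (g1 `|` g2); split; first exact: measurableU.
  apply: (le_trans (measureU2 _ mG1 mG2)); apply: (le_trans (leeD G1 G2)).
  rewrite -EFinD lee_fin mulrDl mul1r lerD //.
    rewrite sum_iota; under eq_bigr do rewrite mul1r.
    rewrite sumr_const card_ord -[_ *+ N]mulr_natl invrK.
    have NT : N%:R * bb <= D%:R.
      by rewrite ler_pdivrMr ?ltr0n // -natrM ler_nat mulnC ltnW // -ltn_divLR.
    have DJ : D%:R <= 2 ^+ (n + n + 3) :> R by rewrite -natrX ler_nat discr_quot_le.
    have n2 : n%:R <= 2 ^+ n :> R by rewrite -natrX ler_nat ltnW // ltn_expl.
    have eJ : 2 ^+ J = 2 ^+ (n + n + 3) * 2 ^+ n * 2 :> R.
      have -> : J = ((n + n + 3) + n).+1 by clear; rewrite /J; lia.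
      by rewrite exprSr exprD.
    have p0 : 0 < 2 ^+ (n + n + 3) :> R by rewrite exprn_gt0.
    have p1 : 0 < 2 ^+ n :> R by rewrite exprn_gt0.
    apply: (@le_trans _ _ (2 ^+ n)^-1); last by rewrite lef_pV2 ?posrE.
    have -> : (2 ^+ n)^-1 = 2 ^+ (n + n + 3) / 2 ^+ J * 2 :> R.
      by rewrite eJ; field; rewrite !gt_eqF.
    rewrite ler_pM2r // [leLHS]mulrA ler_pM2r ?invr_gt0 ?exprn_gt0 //.
    exact: le_trans NT DJ.
  have -> : \sum_(i <- r) b i * m i = N%:R * (2 * (3 * n%:R + 4)).
    rewrite /r big_allpairs_dep sum_iota.
    under eq_bigr => k _.
      rewrite sum_iota; under eq_bigr => j _.
        have -> : b (k : nat, j : nat) * m (k : nat, j : nat) = 2.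
          rewrite /b /m /= exprS; field.
          by rewrite !gt_eqF // exprn_gt0.
        over.
      rewrite sumr_const card_ord; over.
    by rewrite sumr_const card_ord -[_ *+ N]mulr_natl -[2 *+ J]mulr_natr natrD natrM.
  rewrite ler_pdivrMr ?mulr_gt0 //.
  have -> : 56 / eta / n%:R * (eta * (N%:R * ln N%:R)) = N%:R * (56 / n%:R * ln N%:R).
    by field; rewrite !gt_eqF.
  by rewrite ler_pM2l.
move=> x x01 nU.
have lo := sum_cut_recip_ge N0 D0 (hD x); have up := sum_recip_le N0 D0 (hD x).
rewrite -birkhoff_recipE // -/T in lo up.
have {}lo : N%:R * ln N%:R - N%:R * (ln D%:R + 3) <= birkhoff_sum alpha (@recip R) N x.
  apply: (le_trans lo); rewrite birkhoff_recipE //; apply: ler_sum => k _.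
  by rewrite cut_recip_le // frac_ge0.
have far (k : 'I_N) : bb / 2 ^+ J <= frac (x + k%:R * alpha).
  rewrite leNgt; apply/negP => h; apply: nU; left.
  rewrite /g1 /= sum_iota; apply: (@lt_le_trans _ _ 1); first by lra.
  rewrite (bigD1 k) //= mul1r indicE (_ : x \in A' k); last exact: mem_set.
  by rewrite lerDl sumr_ge0 // => j _; rewrite mul1r.
have {}up : birkhoff_sum alpha (@recip R) N x
    <= N%:R * ln N%:R + 3 * N%:R + eta * (N%:R * ln N%:R).
  apply: (le_trans up); rewrite lerD2l.
  have : ~ g2 x by move=> h; apply: nU; right.
  rewrite /g2 /= => /negP; rewrite -leNgt; apply: le_trans.
  rewrite /r big_allpairs_dep sum_iota [leLHS]big_mkcond /=; apply: ler_sum => k _.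
  rewrite sum_iota; case: ifPn => h; last first.
    by apply: sumr_ge0 => j _; rewrite mulr_ge0.
  apply: (le_trans (recip_le_dyadic bb0 (far k) h)).
  apply: ler_sum => j _; rewrite (ler_wpM2l (b0 (k : nat, j : nat))) //.
  rewrite indicE ler_nat.
  by case: ltP => // h'; rewrite (_ : x \in _) //; apply: mem_set.
set S := birkhoff_sum _ _ _ _ in lo up *.
have -> : S / (N%:R * ln N%:R) - 1 = (S - N%:R * ln N%:R) / (N%:R * ln N%:R).
  by rewrite mulrBl divff ?gt_eqF.
rewrite normrM [X in _ * X]ger0_norm ?invr_ge0 ?(ltW NL0) // ler_pdivrMr //.
have e1 := ler_wpM2l (ltW N0R) err1; rewrite -/D in e1.
have e2 := ler_wpM2l (ltW N0R) err2.
have e3 : 0 <= eta * (N%:R * ln N%:R) by rewrite mulr_ge0 // ltW.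
have e4 : (eta + 12 / n%:R) * (N%:R * ln N%:R)
   = eta * (N%:R * ln N%:R) + N%:R * (12 / n%:R * ln N%:R) by ring.
rewrite e4 ler_norml; apply/andP; split; lra.
Qed.

Lemma cf_den_block a n0 N : (forall k, (0 < a k)%N) -> (cf_den a n0 <= N)%N ->
  exists2 n, (n0 <= n)%N & (cf_den a n <= N < cf_den a n.+1)%N.
Proof.
move=> a0 qN.
have ex : exists n, (N < cf_den a n)%N by exists N.+1; exact: cf_den_ge.
case: (ex_minnP ex) => [[|n]] h hmin.
  by move: (leq_ltn_trans qN h); rewrite ltnNge cf_den_le.
exists n; last by rewrite h andbT leqNgt; apply/negP => /hmin; rewrite ltnn.
rewrite leqNgt; apply/negP => nn0.
by move: (leq_ltn_trans qN h); rewrite ltnNge cf_den_le.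
Qed.

Lemma weak_law (R : realType) (alpha eps e : R) :
  (forall k, 0 < cf_err quot alpha k) -> 0 < eps -> 0 < e ->
  exists N0, forall N, (N0 <= N)%N -> exists U : set R, [/\ measurable U,
    (lebesgue_measure U <= e%:E)%E &
    [set x : R | 0 <= x < 1 /\
      `|birkhoff_sum alpha (@recip R) N x / (N%:R * ln N%:R) - 1| > eps] `<=` U].
Proof.
move=> herr eps0 e0.
pose eta := eps / 2; have eta0 : 0 < eta by rewrite divr_gt0.
pose c := 1 + 56 / eta; have c0 : 0 < c by rewrite addr_gt0 // divr_gt0.
pose B := 10 + 12 / eta + c / e.
have B0 : 0 <= B by rewrite !addr_ge0 // divr_ge0 // ltW.
pose n0 := (Num.truncn B).+1; exists (cf_den quot n0) => N qN.
have [n nn0 block] := cf_den_block quot_gt0 qN.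
have nB : B <= n%:R.
  apply: ltW; apply: lt_le_trans (truncnS_gt B) _; by rewrite ler_nat.
have h1 : 0 < 12 / eta by rewrite divr_gt0.
have h2 : 0 < c / e by rewrite divr_gt0.
have n10 : (10 <= n)%N by rewrite -(ler_nat R); rewrite /B in nB; lra.
have n0R : 0 < n%:R :> R by rewrite ltr0n; lia.
have [U [mU U1 U2]] := weak_law_block herr n10 eta0 block.
exists U; split => //.
  apply: (le_trans U1); rewrite lee_fin -/c ler_pdivrMr // mulrC -ler_pdivrMr //.
  by rewrite /B in nB; lra.
move=> x [x01 h]; apply: contrapT => /(U2 _ x01).
have : 12 / n%:R <= eta.
  by rewrite ler_pdivrMr // mulrC -ler_pdivrMr //; rewrite /B in nB; lra.
rewrite /eta in h1 *; lra.
Qed.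

(** * Almost every point enters infinitely many windows *)

(** All bounds come from 1/2 <= q_{n+1} err_n <= 1. The second and
    the fourth say that the expected number q_n L_n of visits lies between
    1 / (4 (n + 1)) and 1 / (n + 1). *)
Lemma window_bounds (R : realType) (alpha : R) n :
  (forall k, 0 < cf_err quot alpha k) ->
  [/\ 0 < window alpha n, n.+1%:R * ((cf_den quot n)%:R * window alpha n) <= 1,
      n.+1%:R * window alpha n <= 1,
      1 <= 4 * n.+1%:R * ((cf_den quot n)%:R * window alpha n) &
      (2 ^ n)%N%:R <= 2 * ((cf_den quot n.+1)%:R * window alpha n)].
Proof.
move=> herr; rewrite /window; set d := cf_err _ _ _; set m := (2 ^ n)%N.
set q := cf_den quot n; set q' := cf_den quot n.+1.
have d0 : 0 < d := herr n.
have m0 : (0 < m)%N by rewrite expn_gt0.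
have q0 : (0 < q)%N by rewrite cf_den_gt0 //; exact: quot_gt0.
have lo : (n.+1 * m * q <= q')%N by exact: cf_den_geM.
have up : (q' <= (n.+1 * m).+1 * q)%N by exact: cf_den_leM quot_gt0.
have d1 : q'%:R * d <= 1 by exact: cf_err_le quot_gt0 herr.
have d2 : 1 <= 2 * (q'%:R * d) by exact: cf_err_ge quot_gt0 herr.
have c1 : n.+1%:R * (q%:R * (m%:R * d)) <= 1.
  apply: le_trans d1; rewrite [q%:R * _]mulrA [leLHS]mulrA -!natrM ler_pM2r // ler_nat.
  by rewrite [(q * m)%N]mulnC mulnA.
split => //.
- by rewrite (mulr_gt0 _ d0) // ltr0n.
- apply: le_trans c1; rewrite ler_pM2l // ler_peMl ?ler1n //.
  by rewrite mulr_ge0 // ltW.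
- apply: (le_trans d2).
  have -> : 4 * n.+1%:R * (q%:R * (m%:R * d)) = 2 * ((2 * (n.+1 * m * q))%N%:R * d).
    by rewrite !natrM; ring.
  rewrite ler_pM2l // ler_pM2r // ler_nat; apply: (leq_trans up).
  by rewrite mulnA leq_mul2r; apply/orP; right; rewrite mul2n -addnn -addn1 leq_add2l muln_gt0.
- have -> : 2 * (q'%:R * (m%:R * d)) = m%:R * (2 * (q'%:R * d)) by ring.
  by rewrite ler_peMr.
Qed.

(** A given window of width L meets at most q_{n'} (L + L') + 3 of the windows of
    level n', by hits_block. The 3 is relatively small when n < n', because
    q_{n'} L is then at least 2^n / 2. *)
Lemma window_pairs (R : realType) (alpha L L' : R) (n n' q q' : nat) :
  (forall k, 0 < cf_err quot alpha k) -> (0 < n)%N -> (n <= n')%N ->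
  L = window alpha n -> L' = window alpha n' ->
  q = cf_den quot n -> q' = cf_den quot n' ->
  \sum_(i < q) \sum_(j < q')
     (frac ((j%:R * alpha + L') - (i%:R * alpha + L) + L) < L + L')%R%:R * L'
   <= (n == n')%:R * (5 * (q%:R * L))
      + (1 + 8 / 2 ^+ n) * ((q%:R * L) * (q'%:R * L')).
Proof.
move=> herr n0 nn' EL EL' Eq Eq'.
have [L0 qL nL _ q'L] := window_bounds n herr.
have [L0' qL' nL' _ _] := window_bounds n' herr.
rewrite -EL -?Eq in L0 qL nL q'L; rewrite -EL' -?Eq' in L0' qL' nL'.
have small (k : nat) (w : R) : (0 < k)%N -> 0 < w -> k.+1%:R * w <= 1 -> w <= 2^-1.
  move=> k0 w0 h; rewrite -[leRHS]mul1r ler_pdivlMr // mulrC; apply: le_trans h.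
  by rewrite ler_pM2r // ler_nat.
have s1 := small _ _ n0 L0 nL.
have s2 := small _ _ (leq_trans n0 nn') L0' nL'.
have y01 : 0 <= L + L' <= 1 by apply/andP; split; lra.
have p'1 : q'%:R * L' <= 1.
  apply: le_trans qL'; rewrite ler_peMl ?ler1n //.
  by rewrite mulr_ge0 // ltW.
have row (i : 'I_q) : \sum_(j < q')
     (frac ((j%:R * alpha + L') - (i%:R * alpha + L) + L) < L + L')%R%:R * L'
     <= (q'%:R * L + 4) * L'.
  rewrite -mulr_suml ler_pM2r //.
  have q0 : (0 < q')%N by rewrite Eq' cf_den_gt0 //; exact: quot_gt0.
  have pq := cf_coprime quot n'; have blk := cf_err_block n' quot_gt0 herr.
  rewrite -Eq' in pq blk; have := hits_block (L' - i%:R * alpha) q0 pq blk y01.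
  rewrite ler_norml => /andP[_]; rewrite /hits natr_sum.
  under eq_bigr => j _.
    have -> : L' - i%:R * alpha + j%:R * alpha
      = (j%:R * alpha + L') - (i%:R * alpha + L) + L by ring.
    over.
  by rewrite mulrDr; lra.
apply: (le_trans (ler_sum _ (fun i _ => row i))).
rewrite sumr_const card_ord -[_ *+ q]mulr_natl.
have qL0 : 0 <= q%:R * L by rewrite mulr_ge0 // ltW.
have qL0' : 0 <= q'%:R * L' by rewrite mulr_ge0 // ltW.
have tn : 0 < 2 ^+ n :> R by rewrite exprn_gt0.
move: nn'; rewrite leq_eqVlt => /orP[/eqP nn'|nn'].
  have e1 : q' = q by rewrite Eq' -nn'.
  have e2 : L' = L by rewrite EL' -nn'.
  rewrite (_ : (n == n')%:R = 1) ?nn' ?eqxx // mul1r e1 e2.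
  have h : 0 <= 8 / 2 ^+ n' * (q%:R * L * (q%:R * L)).
    by rewrite !mulr_ge0 // ?(ltW L0) // invr_ge0 exprn_ge0.
  have -> : q%:R * ((q%:R * L + 4) * L) = q%:R * L * (q%:R * L) + 4 * (q%:R * L) by ring.
  rewrite mulrDl mul1r; lra.
rewrite ltn_eqF // mul0r add0r.
have q'L4 : 2 ^+ n <= 2 * (q'%:R * L).
  rewrite -natrX; apply: (le_trans q'L); rewrite ler_pM2l // ler_pM2r // ler_nat.
  by rewrite Eq'; apply: cf_den_le => //; exact: quot_gt0.
have key : 4 <= 8 / 2 ^+ n * (q'%:R * L).
  have -> : 8 / 2 ^+ n * (q'%:R * L) = 4 * (2 * (q'%:R * L) / 2 ^+ n) by field; rewrite gt_eqF.
  by rewrite -[leLHS]mulr1 ler_pM2l // ler_pdivlMr // mul1r.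
have qL'0 : 0 <= q%:R * L' by rewrite mulr_ge0 // ltW.
have := ler_wpM2l qL'0 key.
have -> : q%:R * L' * (8 / 2 ^+ n * (q'%:R * L))
   = 8 / 2 ^+ n * (q%:R * L * (q'%:R * L')) by ring.
have -> : q%:R * ((q'%:R * L + 4) * L') = q%:R * L * (q'%:R * L') + q%:R * L' * 4 by ring.
rewrite mulrDl mul1r; lra.
Qed.

Lemma window_sum_unbounded (R : realType) (alpha : R) (k1 : nat) (B : R) :
  (forall k, 0 < cf_err quot alpha k) ->
  exists len, B <= \sum_(k < len)
    (cf_den quot (k1 + k).*2)%:R * window alpha (k1 + k).*2.
Proof.
move=> herr; pose y : R := 8 * B + harm R k1.
pose M := Num.truncn (expR y); exists M.
apply: (@le_trans _ _ ((harm R (k1 + M) - harm R k1) / 8)).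
  rewrite ler_pdivlMr // lerBrDr mulrC -/y.
  apply: (@le_trans _ _ (ln (k1 + M).+1%:R)); last exact: ln_le_harm.
  rewrite -[leLHS]expRK ler_ln ?posrE ?expR_gt0 ?ltr0n //.
  apply: (@le_trans _ _ M.+1%:R); first by apply: ltW; exact: truncnS_gt.
  by rewrite ler_nat ltnS leq_addl.
rewrite /harm big_split_ord /= addrAC subrr add0r mulr_suml; apply: ler_sum => k _.
have [L0 _ _ h _] := window_bounds (k1 + k).*2 herr.
rewrite -invfM -[leLHS]mul1r ler_pdivrMr ?mulr_gt0 ?ltr0n //.
apply: (le_trans h); rewrite [leRHS]mulrC ler_wpM2r //.
  by rewrite mulr_ge0 // ltW.
by rewrite -!natrM ler_nat; lia.
Qed.

(** The second moment bound gives measure at most 5 / P + 8 / 2^n to the points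
    that miss all windows from level n on, P being the expected number of visits
    up to some later level. *)
Lemma no_window_small (R : realType) (alpha e : R) (k0 : nat) :
  (forall k, 0 < cf_err quot alpha k) -> 0 < e ->
  exists U : set R, [/\ measurable U, (lebesgue_measure U <= e%:E)%E &
    [set x | 0 <= x < 1 /\ forall k, (k0 <= k)%N ->
       forall i, (i < cf_den quot k.*2)%N ->
       ~ hit_set (i%:R * alpha + window alpha k.*2) (window alpha k.*2) x]
    `<=` U].
Proof.
move=> herr e0.
(* Each of the two terms of the bound is made at most e / 2: the second one by
   starting at k1, the first one by the choice of len below. *)
pose k1 := (k0 + (Num.truncn (16 / e)).+1)%N.
have k1_gt0 : (0 < k1)%N by rewrite /k1 addnS.
have eta_le : 8 / 2 ^+ k1.*2 <= e / 2.
  have p : 0 < 2 ^+ k1.*2 :> R by rewrite exprn_gt0.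
  have : 16 / e <= 2 ^+ k1.*2.
    apply: (@le_trans _ _ k1%:R).
      apply: (@le_trans _ _ (Num.truncn (16 / e)).+1%:R); first by apply: ltW; exact: truncnS_gt.
      by rewrite ler_nat leq_addl.
    rewrite -natrX ler_nat; apply: (@leq_trans (2 ^ k1)).
      by rewrite ltnW // ltn_expl.
    by rewrite leq_exp2l // -addnn leq_addr.
  by rewrite !ler_pdivrMr //; lra.
have [len Plen] := window_sum_unbounded k1 (10 / e) herr.
pose nn k := (k1 + k).*2; pose L k := window alpha (nn k).
pose q k := cf_den quot (nn k).
rewrite -/nn in Plen.
have L0 k : 0 < L k by have [] := window_bounds (nn k) herr.
have L01 k : 0 <= L k <= 1.
  have [_ _ h _ _] := window_bounds (nn k) herr; rewrite (ltW (L0 k)) /=.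
  by apply: le_trans h; rewrite ler_peMl ?ler1n // ltW.
pose r := [seq (k, i) | k <- iota 0 len, i <- iota 0 (q k)].
pose A (s : nat * nat) := hit_set (s.2%:R * alpha + L s.1) (L s.1).
have mA s : measurable (A s) by exact: measurable_hit_set.
have muA s : lebesgue_measure (A s) = (L s.1)%:E by exact: measure_hit_set.
(* A bound for the overlap that counts well when t is the later level; Q puts
   the two indices in this order. *)
pose kap (s t : nat * nat) : R :=
  (frac ((t.2%:R * alpha + L t.1) - (s.2%:R * alpha + L s.1) + L s.1)
     < L s.1 + L t.1)%R%:R * L t.1.
have kapP s t : (lebesgue_measure (A s `&` A t) <= (kap s t)%:E)%E.
  rewrite /kap; case: ltP => h.
    rewrite mul1r -muA; apply: lebesgue_measureS; exact: subIsetr.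
  rewrite mul0r (_ : _ `&` _ = set0) ?measure0 //.
  apply/seteqP; split => // x [hs ht]; have := hit_setI hs ht; lra.
pose Q s t := if (s.1 <= t.1)%N then kap s t else kap t s.
have QP s t : (lebesgue_measure (A s `&` A t) <= (Q s t)%:E)%E.
  by rewrite /Q; case: ifP => _; [exact: kapP|rewrite setIC; exact: kapP].
pose I01 : set R := `[0, 1[%classic.
pose G := I01 `\` \big[setU/set0]_(s <- r) A s.
have mD : measurable (I01) by exact: measurable_itv.
have mG : measurable G by apply: measurableD => //; exact: bigsetU_measurable.
have D1 : lebesgue_measure (I01) = 1%E.
  by rewrite /I01 lebesgue_measure_itv /= lte_fin ltr01 sube0.
have GD : G `<=` I01 by exact: subDsetl.
have AD s : A s `<=` I01 by move=> x [x01 _]; rewrite /I01 /= in_itv.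
have GA s : s \in r -> G `&` A s = set0.
  move=> sr; apply/seteqP; split => // x [[_ nx] Ax]; apply: nx.
  by rewrite -bigcup_seq; exists s.
have Gfin : (lebesgue_measure G \is a fin_num)%E.
  rewrite ge0_fin_numE //; apply: (@le_lt_trans _ _ 1%E); last exact: ltry.
  by rewrite -D1; apply: lebesgue_measureS.
have muG : lebesgue_measure G = (fine (lebesgue_measure G))%:E by rewrite fineK.
have := second_moment (mu := @lebesgue_measure R) mD mG mA D1 GD AD GA muG muA QP.
set g := fine _ in muG *.
pose P := \sum_(k < len) (q k)%:R * L k.
have -> : \sum_(s <- r) L s.1 = P.
  rewrite /r big_allpairs_dep sum_iota; apply: eq_bigr => k _.
  by rewrite sum_iota /= sumr_const card_ord mulr_natl.
have QB : \sum_(s <- r) \sum_(t <- r) Q s t <= 5 * P + (1 + e / 2) * P ^+ 2.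
  have -> : \sum_(s <- r) \sum_(t <- r) Q s t
    = \sum_(k < len) \sum_(l < len) \sum_(i < q k) \sum_(j < q l) Q (k : nat, i : nat) (l : nat, j : nat).
    rewrite /r big_allpairs_dep sum_iota; apply: eq_bigr => k _.
    rewrite sum_iota exchange_big /= big_allpairs_dep sum_iota; apply: eq_bigr => l _.
    by rewrite sum_iota exchange_big.
  have cell (k l : nat) : \sum_(i < q k) \sum_(j < q l) Q (k, i : nat) (l, j : nat)
     <= (k == l)%:R * (5 * ((q k)%:R * L k))
        + (1 + e / 2) * ((q k)%:R * L k * ((q l)%:R * L l)).
    have nn0 k' : (0 < nn k')%N by rewrite /nn double_gt0 addn_gt0 k1_gt0.
    have pp (k' l' : nat) : (k' <= l')%N ->
        \sum_(i < q k') \sum_(j < q l') kap (k', i : nat) (l', j : nat)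
        <= (k' == l')%:R * (5 * ((q k')%:R * L k'))
           + (1 + e / 2) * ((q k')%:R * L k' * ((q l')%:R * L l')).
      move=> kl.
      have nkl : (nn k' <= nn l')%N by rewrite leq_double leq_add2l.
      have := window_pairs herr (nn0 k') nkl (erefl (L k')) (erefl (L l'))
                (erefl (q k')) (erefl (q l')).
      have -> : (nn k' == nn l') = (k' == l').
        by rewrite (inj_eq double_inj) eqn_add2l.
      move/le_trans; apply; rewrite lerD2l ler_wpM2r //.
        by apply: mulr_ge0; apply: mulr_ge0 => //; exact: ltW (L0 _).
      rewrite lerD2l; apply: le_trans eta_le.
      rewrite ler_pM2l // lef_pV2 ?posrE ?exprn_gt0 // ler_eXn2l ?ltr1n //.
      by rewrite leq_double leq_addr.
    have [kl|lk] := leqP k l.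
      by under eq_bigr do under eq_bigr do rewrite /Q /= kl; exact: pp.
    under eq_bigr do under eq_bigr do rewrite /Q /= leqNgt lk /=.
    rewrite exchange_big /=; apply: (le_trans (pp _ _ (ltnW lk))).
    by rewrite (ltn_eqF lk) (gtn_eqF lk) !mul0r [(q l)%:R * L l * _]mulrC.
  apply: (@le_trans _ _ (\sum_(k < len) \sum_(l < len)
      ((k == l :> nat)%:R * (5 * ((q k)%:R * L k))
        + (1 + e / 2) * ((q k)%:R * L k * ((q l)%:R * L l))))).
    by apply: ler_sum => k _; apply: ler_sum => l _; exact: cell.
  under eq_bigr do rewrite big_split /=.
  rewrite big_split /= lerD //.
    rewrite /P mulr_sumr; apply: ler_sum => k _.
    rewrite (bigD1 k) //= eqxx mul1r big1 ?addr0 // => l lk.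
    by rewrite eq_sym (_ : (_ == _) = false) ?mul0r //; apply/negbTE.
  rewrite expr2 {1}/P mulr_suml mulr_sumr; apply: ler_sum => k _.
  by rewrite /P mulr_sumr mulr_sumr.
move=> H.
have P0 : 10 / e <= P by [].
have P00 : 0 < P by apply: lt_le_trans P0; rewrite divr_gt0.
have {}H : g * P ^+ 2 <= 5 * P + e / 2 * P ^+ 2.
  by move: (le_trans H QB); rewrite !mulrDl !mul1r; lra.
have ge : g <= e.
  have h5 : 5 * P <= e / 2 * P ^+ 2.
    rewrite expr2 mulrA ler_pM2r //.
    by move: P0; rewrite ler_pdivrMr // => P0; lra.
  have : g * P ^+ 2 <= e * P ^+ 2 by lra.
  by rewrite ler_pM2r // exprn_gt0.
exists G; split => //; first by rewrite muG lee_fin.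
move=> x [x01 hx]; split; first by rewrite /I01 /= in_itv.
rewrite -bigcup_seq => -[[k i] /= sr].
move: sr => /allpairsPdep[k' [i' [_ ir [-> ->]]]].
apply: hx; first by rewrite /k1 -addnA leq_addr.
by move: ir; rewrite mem_iota add0n.
Qed.

(** * Passage to almost every point *)

Lemma negligible_small (R : realType) (A : set R) :
  (forall e : R, 0 < e -> exists U : set R,
     [/\ measurable U, (lebesgue_measure U <= e%:E)%E & A `<=` U]) ->
  (@lebesgue_measure R).-negligible A.
Proof.
move=> h.
have pos k : 0 < k.+1%:R^-1 :> R by rewrite invr_gt0 ltr0n.
pose U k := projT1 (cid (h _ (pos k))).
have UP k : [/\ measurable (U k), (lebesgue_measure (U k) <= (k.+1%:R^-1)%:E)%E &
    A `<=` U k] by rewrite /U; case: cid.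
have mU k : measurable (U k) by case: (UP k).
exists (\bigcap_k U k); split; last by move=> x Ax k _; have [_ _] := UP k; exact.
  exact: bigcapT_measurable.
apply/eqP; rewrite eq_le measure_ge0 andbT.
apply/lee_addgt0Pr => e e0; rewrite add0e.
pose k := Num.truncn e^-1.
apply: (@le_trans _ _ (lebesgue_measure (U k))).
  by apply: lebesgue_measureS; exact: bigcap_inf.
have [_ Uk _] := UP k; apply: (le_trans Uk); rewrite lee_fin.
rewrite -[leRHS]invrK lef_pV2 ?posrE ?invr_gt0 ?ltr0n //.
by apply: ltW; exact: truncnS_gt.
Qed.

Lemma limn_esup_ge (R : realType) (u : nat -> \bar R) (c : \bar R) :
  (forall M, exists2 N, (M <= N)%N & (c <= u N)%E) -> (c <= limn_esup u)%E.
Proof.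
move=> h; rewrite limn_esup_lim; apply: lime_ge; first exact: is_cvg_esups.
apply: nearW => M; have [N MN cN] := h M.
by apply: (le_trans cN); apply: ereal_sup_ubound; exists N.
Qed.

Lemma limn_einf_le (R : realType) (u : nat -> \bar R) (c : \bar R) :
  (forall M, exists2 N, (M <= N)%N & (u N <= c)%E) -> (limn_einf u <= c)%E.
Proof.
move=> h; rewrite limn_einf_lim; apply: lime_le; first exact: is_cvg_einfs.
apply: nearW => M; have [N MN cN] := h M.
by apply: le_trans cN; apply: ereal_inf_lbound; exists N.
Qed.

Lemma windows_ae (R : realType) (alpha : R) :
  (forall k, 0 < cf_err quot alpha k) ->
  {ae @lebesgue_measure R, forall x : R, 0 <= x < 1 ->
     forall k0, exists k i, [/\ (k0 <= k)%N, (i < cf_den quot k.*2)%N &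
       hit_set (i%:R * alpha + window alpha k.*2) (window alpha k.*2) x]}.
Proof.
move=> herr.
have n0 k0 := negligible_small (fun e => @no_window_small R alpha e k0 herr).
apply: negligibleS (negligible_bigcup n0) => x /= /not_implyP[x01].
move=> /existsNP[k0 hk0]; exists k0 => //; split => // k kk0 i iq hx.
by apply: hk0; exists k, i.
Qed.

(** Where the inferior limit exceeds 1, the quotient stays above 1 + 1/(k+1)
    from some index M on; the convergence in measure makes this a null set for
    each k and M. *)
Lemma birkhoff_small_ae (R : realType) (alpha : R) :
  (forall k, 0 < cf_err quot alpha k) ->
  {ae @lebesgue_measure R, forall x : R, 0 <= x < 1 ->
     forall k M, exists2 N, (M <= N)%N &
       birkhoff_sum alpha (@recip R) N x / (N%:R * ln N%:R) <= 1 + k.+1%:R^-1}.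
Proof.
move=> herr.
pose B k M := [set x : R | 0 <= x < 1 /\ forall N, (M <= N)%N ->
  1 + k.+1%:R^-1 < birkhoff_sum alpha (@recip R) N x / (N%:R * ln N%:R)].
have nB k M : (@lebesgue_measure R).-negligible (B k M).
  apply: negligible_small => e e0.
  have k0 : 0 < k.+1%:R^-1 :> R by rewrite invr_gt0 ltr0n.
  have [N0 hN0] := weak_law herr k0 e0.
  have [U [mU Ue sub]] := hN0 _ (leq_maxr M N0); exists U; split => //.
  move=> x [x01 hx]; apply: sub; split => //.
  have := hx _ (leq_maxl M N0); set s := _ / _ => hs.
  by apply: lt_le_trans (ler_norm _); rewrite ltrBrDl.
have nBk k := negligible_bigcup (nB k).
apply: negligibleS (negligible_bigcup nBk) => x /= /not_implyP[x01].
move=> /existsNP[k /existsNP[M h]]; exists k => //; exists M => //; split => // N MN.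
by rewrite ltNge; apply/negP => hN; apply: h; exists N.
Qed.

Theorem theorem11 (R : realType) :
  exists alpha : R,
    [/\ 0 < alpha < 1,
        irrational alpha,
        (forall eps : R, 0 < eps ->
          (fun N : nat => lebesgue_measure
             [set x : R | 0 <= x < 1 /\
                `|birkhoff_sum alpha (@recip R) N x / (N%:R * ln N%:R) - 1|
                  > eps])
            @ \oo --> (0 : \bar R)%E)
      & (forall K : nat, (1 <= K)%N ->
          {ae @lebesgue_measure R, forall x : R, 0 <= x < 1 ->
            (limn_esup (fun N : nat =>
               (trimmed_sum alpha (@recip R) K N x / (N%:R * ln N%:R))%:E)
             > 1)%E /\
            (1 >= limn_einf (fun N : nat =>
               (trimmed_sum alpha (@recip R) K N x / (N%:R * ln N%:R))%:E))%E})].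
Proof.
have [alpha herr] := @cf_exists R quot quot_gt0; exists alpha; split.
- have := herr 0%N; have := herr 1%N; rewrite /cf_err.
  rewrite (_ : cf_den quot 0 = 1%N) // (_ : cf_den quot 1 = 1%N) //.
  rewrite (_ : cf_num quot 0 = 0%N) // (_ : cf_num quot 1 = 1%N) //.
  by rewrite expr0 expr1 subr0 !mul1r mulN1r opprB subr_gt0 => -> ->.
- by move=> [r _ er]; apply: (cf_irrational quot_gt0 herr); exists r.
- move=> eps eps0; set u := fun N : nat => _.
  have small e : 0 < e -> \forall N \near \oo, (u N <= e%:E)%E.
    move=> e0; have [N0 hN0] := weak_law herr eps0 e0.
    exists N0 => // N /= /hN0[U [_ Ue sub]]; apply: le_trans Ue.
    exact: lebesgue_measureS.
  have u0 N : (0 <= u N)%E by exact: measure_ge0.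
  apply/fine_cvgP; split.
    apply: filterS (small 1 ltr01) => N uN.
    by rewrite ge0_fin_numE //; apply: le_lt_trans uN _; exact: ltry.
  apply/cvgrPdist_le => e e0; apply: filterS (small e e0) => N uN /=.
  rewrite sub0r normrN ger0_norm ?fine_ge0 // -lee_fin fineK //.
  by rewrite ge0_fin_numE //; apply: le_lt_trans uN _; exact: ltry.
- move=> K _.
  have near1 := windows_ae herr; have near2 := birkhoff_small_ae herr.
  apply: negligibleS (negligibleU near1 near2) => x /= nh.
  apply: contrapT => /not_orP[/contrapT h1 /contrapT h2]; apply: nh => x01.
  split.
    apply: (@lt_le_trans _ _ (1 + 6^-1)%:E); first by rewrite lte_fin; lra.
    apply: limn_esup_ge => M.
    have [k [i [kk iq hx]]] := h1 x01 (maxn M (24 * K + 100)).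
    have nK : (24 * K + 100 <= k.*2)%N.
      by rewrite -addnn; apply: leq_trans (leq_addr _ _); apply: leq_trans kk; exact: leq_maxr.
    have en : ~~ odd k.*2 by rewrite odd_double.
    have big := trimmed_large herr en nK iq hx erefl.
    set N := (_ * _)%N in big; exists N.
      apply: (@leq_trans k.*2); first by rewrite -addnn; apply: leq_trans (leq_addr _ _); apply: leq_trans kk; exact: leq_maxl.
      rewrite /N; apply: leq_trans (leq_pmulr _ _); last by rewrite cf_den_gt0 //; exact: quot_gt0.
      by rewrite -addnA; apply: leq_trans (leq_addr _ _); rewrite ltnW // ltn_expl.
    rewrite lee_fin ler_pdivlMr //.
    have N1 : (1 < N)%N.
      rewrite /N; apply: leq_trans (leq_pmulr _ _); last by rewrite cf_den_gt0 //; exact: quot_gt0.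
      by rewrite addn1 ltnS addn_gt0 expn_gt0.
    by rewrite mulr_gt0 ?ltr0n ?ln_gt0 ?ltr1n // ltnW.
  apply/lee_addgt0Pr => e e0.
  pose k := Num.truncn e^-1.
  apply: (@le_trans _ _ (1 + k.+1%:R^-1)%:E); last first.
    rewrite EFinD leeD2l // lee_fin -[leRHS]invrK lef_pV2 ?posrE ?invr_gt0 ?ltr0n //.
    by apply: ltW; exact: truncnS_gt.
  apply: limn_einf_le => M; have [N MN hN] := h2 x01 k M; exists N => //.
  rewrite lee_fin; apply: le_trans hN.
  rewrite ler_wpM2r //; last exact: trimmed_le_birkhoff.
  case: N MN => [|N] _; first by rewrite mul0r invr0.
  by rewrite invr_ge0 mulr_ge0 // ln_ge0 // ler1n.
Qed.
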